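(* Suppose $P(V_1>x)\sim L(x)x^{-\alpha}$ as $x\to\infty$, where $\alpha>2$ and $L$ is slowly varying, and let $\kappa=(\alpha-2)E[V_1^2]/(2E[V_1])$. Suppose that $\hat\rho=\hat\rho(x)$ satisfies $$\hat\rho(x)=1-c\,\kappa\,(\log x)/x,$$ where $c>0$ is a constant. (a) If $0<c<1$, then $$\sup_{\hat\rho(x)\le\rho<1}\left|\frac{P(W_\infty(\rho)>x)}{\exp\bigl(-2(1-\rho)E[V_1]\,x/E[V_1^2]\bigr)}-1\right|\to 0\quad\text{as }x\to\infty.$$ This relation continues to hold when $c=1$, provided that $L(x)/\log x\to 0$ as $x\to\infty$. (b) If $c>1$, then $$\sup_{0<\rho\le\hat\rho(x)}\left|\frac{P(W_\infty(\rho)>x)}{\frac{\rho}{1-\rho}P(X_1>x)}-1\right|\to 0\quad\text{as }x\to\infty.$$ This relation continues to hold when $c=1$, provided that $L(x)/\log x\to\infty$ as $x\to\infty$.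
   Context: Setting: for $\rho\in(0,1)$, $W_\infty(\rho)$ is the steady-state waiting time (exclusive of service) in the M/G/1 first-in first-out queue with i.i.d. nonnegative processing times $V_n$ (whose distribution does not depend on $\rho$) and an independent Poisson arrival process of rate $\lambda=\rho/E[V_1]$. Let $X_1,X_2,\dots$ be i.i.d. with density $g(t)=P(V_1>t)/E[V_1]$ on $(0,\infty)$, and $S_0=0$, $S_n=X_1+\cdots+X_n$. The distribution of $W_\infty(\rho)$ is given by the Pollaczek--Khintchine formula $$P(W_\infty(\rho)>x)=\sum_{n=0}^\infty(1-\rho)\rho^n P(S_n>x),\qquad x\ge 0.$$ Here $f(x)\sim h(x)$ means $f(x)/h(x)\to1$. *)

(* Defs.v *)
From HB Require Import structures.
From mathcomp Require Import all_boot all_order all_algebra.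
From mathcomp Require Import all_classical all_reals all_analysis.

Set Implicit Arguments.
Unset Strict Implicit.
Unset Printing Implicit Defensive.

Import Order.TTheory GRing.Theory Num.Theory.
Import numFieldNormedType.Exports.

Local Open Scope classical_set_scope.
Local Open Scope ring_scope.

(* [L] is only constrained near +oo, as in Bingham-Goldie-Teugels. *)
Definition slowly_varying (R : realType) (L : R -> R) : Prop :=
  (exists a : R, measurable_fun `]a, +oo[ L /\ forall x, a < x -> 0 < L x) /\
  forall t : R, 0 < t -> L (t * x) / L x @[x --> +oo] --> (1 : R).

Definition asymp_equiv (R : realType) (f h : R -> R) : Prop :=
  f x / h x @[x --> +oo] --> (1 : R).

Section random_variables.
Context d (T : measurableType d) (R : realType) (P : probability T R).
Implicit Types X V A W : {RV P >-> R}.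

Definition tail X (x : R) : R := fine (P [set t | x < X t]).

(* [fine] is harmless below: both moments are finite as soon as the tail of the
   nonnegative variable is regularly varying of index smaller than -2. *)
Definition mean X : R := fine 'E_P[X].

Definition second_moment X : R := fine 'E_P[fun t => X t ^+ 2].

Definition has_density_on_pos X (g : R -> R) : Prop :=
  forall B : set R, measurable B ->
    distribution P X B =
      (\int[lebesgue_measure]_(t in B `&` `]0%R, +oo[) (g t)%:E)%E.

Definition exponentially_distributed A (lambda : R) : Prop :=
  forall B : set R, measurable B ->
    distribution P A B = exponential_prob lambda B.

(* In a first-in first-out single-server queue, a customer who waits [w] and
   requires service [v], and is followed [a] time units later by the next
   arrival, makes the next customer wait [lindley (w, (v, a))]. *)
Definition lindley (wva : R * (R * R)) : R :=
  Num.max (wva.1 + wva.2.1 - wva.2.2) 0.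

(* The law of [W] is a stationary law of the Markov chain
     W_(n+1) = max (W_n + V_n - A_(n+1), 0),
   whose increments are independent copies of V - A, with V and A independent.
   The product measure expresses the independence of W_n, V_n and A_(n+1);
   [V], [A], [W] themselves only enter through their marginal laws. *)
Definition steady_state_waiting_time V A W : Prop :=
  forall B : set R, measurable B ->
    distribution P W B =
      (distribution P W \x (distribution P V \x distribution P A))%E
        (lindley @^-1` B).

End random_variables.

(* The supremum is taken in the extended reals, so that it is also meaningful
   when the set is unbounded; convergence to 0 then includes its eventual
   finiteness. *)
Definition uniformly_asymp_equiv (R : realType) (D : R -> set R)
    (f h : R -> R -> R) : Prop :=
  ereal_sup [set (`| f rho x / h rho x - 1 |)%:E | rho in D x]
    @[x --> +oo] --> (0 : \bar R).

(* Main.v *)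
Require Import Defs.
From HB Require Import structures.
From mathcomp Require Import all_boot all_order all_algebra.
From mathcomp Require Import all_classical all_reals all_analysis.
From mathcomp Require Import measurable_realfun.
From mathcomp Require Import ring lra.
Set Implicit Arguments.
Unset Strict Implicit.
Unset Printing Implicit Defensive.
Import Order.TTheory GRing.Theory Num.Theory.
Import numFieldNormedType.Exports.
Local Open Scope classical_set_scope.
Local Open Scope ring_scope.

(** Fix [rho], and let [u x = P(W > x)], [H x = P(X > x)] and
    [theta = (1 - rho) / E X], where [E X = E (V^2) / (2 * E V)]. The random walk
    with steps [X] never enters the proof. Lindley's equation for the stationary
    waiting time, whose interarrival time is exponential, yields the renewal
    equation [u x = rho * E (u (x - X))] for [x >= 0], with [u = 1] on the
    negatives ([lindley_renewal]). Because [rho < 1], this equation satisfies a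
    comparison principle: a function that satisfies it on [0, x0] with an
    inequality instead of the equality bounds [u] there from the corresponding
    side ([comparison_upper], [comparison_lower]). All estimates come from
    explicit functions, which may depend on [x0] and [rho]; this gives the
    uniformity in [rho].

    - The function [expR (- (gamma * x))] bounds [u x0] from above as soon as
      [rho * E (expR (gamma * min(X, x0))) <= 1] ([lundberg_bound]). By the
      moment bound [mgf_trunc_bound], [gamma] can be taken so close to [theta]
      that [(theta - gamma) * x0] vanishes, when [theta <= k * ln x0 / x0] with
      [k < alpha - 2] ([exponential_upper]). A shifted exponential gives the
      matching lower bound ([exponential_lower]).
    - The constant [rho * H x0 / (1 - rho + rho * H x0)], the probability of one
      jump beyond [x0], bounds [u x0] from below ([heavy_tail_lower]).
    - With jumps truncated at a smaller level, constants are added to the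
      exponential to account for larger jumps ([big_jump_upper]). This yields the
      upper bound by [rho / (1 - rho) * H x] ([heavy_tail_upper]) and, at the
      critical value [c = 1], the exponential upper bound
      ([exponential_upper_critical]).

    The exponential and the single large jump balance where [x `^ (- k)], with
    [k = c * (alpha - 2)], meets [x / ln x * H x]. Since [H x] is comparable to
    [L x * x `^ (1 - alpha)], the value [c = 1] is critical and there the ratio
    [L x / ln x] decides. On the side of the tails only regular variation is
    used: it passes from [V] to [X] by integration ([integrated_tail_rv]) and gives
    power bounds on both sides ([potter_upper], [potter_lower]). *)

(** * The renewal equation and its comparison principle *)

Section renewal.
Context (R : realType) (nu : probability R R).
Hypothesis nu_pos : nu `]0, +oo[%classic = 1%E.
Implicit Types (f g u : R -> R) (rho gamma x y b : R).

(** The law [nu] is carried by the positive half-line; integrating only there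
    makes it enough to compare integrands at positive points. *)
Definition expect f : R := \int[nu]_(y in `]0, +oo[) f y.

Definition survival x : R := fine (nu `]x, +oo[%classic).

Definition bounded_meas f : Prop :=
  measurable_fun setT f /\ exists M, forall y, 0 < y -> `|f y| <= M.

Lemma bounded_meas_integrable f :
  bounded_meas f -> nu.-integrable `]0, +oo[%classic (EFin \o f).
Proof.
move=> [mf [M fM]]; apply: measurable_bounded_integrable => //.
- by rewrite ltey_eq fin_num_measure.
- exact: measurable_funS mf.
- exists M; split; first exact: num_real.
  move=> N MN y /=; rewrite in_itv/= andbT => y0.
  by rewrite (le_trans (fM _ y0))// ltW.
Qed.

Lemma bounded_measD f g : bounded_meas f -> bounded_meas g ->
  bounded_meas (fun y => f y + g y).
Proof.
move=> [mf [M fM]] [mg [N gN]]; split; first exact: measurable_funD.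
exists (M + N) => y y0; rewrite (le_trans (ler_normD _ _))// lerD ?fM ?gN//.
Qed.

Lemma bounded_meas_cst c : bounded_meas (fun=> c).
Proof. by split; [exact: measurable_cst | exists `|c| => y _]. Qed.

Lemma bounded_measZ c f : bounded_meas f -> bounded_meas (fun y => c * f y).
Proof.
move=> [mf [M fM]]; split; first exact: measurable_funM.
by exists (`|c| * M) => y y0; rewrite normrM ler_wpM2l// fM.
Qed.

Lemma bounded_meas_indic b : bounded_meas (fun y => \1_(`]b, +oo[%classic) y).
Proof.
split; first exact: measurable_indic.
by exists 1 => y _; rewrite indicE ger0_norm// lern1 leq_b1.
Qed.

Lemma expectD f g : bounded_meas f -> bounded_meas g ->
  expect (fun y => f y + g y) = expect f + expect g.
Proof.
by move=> bf bg; rewrite /expect RintegralD//; apply: bounded_meas_integrable.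
Qed.

Lemma expectZ c f : bounded_meas f -> expect (fun y => c * f y) = c * expect f.
Proof.
by move=> bf; rewrite /expect RintegralZl//; apply: bounded_meas_integrable.
Qed.

Lemma expect_cst c : expect (fun=> c) = c.
Proof. by rewrite /expect Rintegral_cst// [X in fine X](_ : _ = 1%E) ?mulr1 ?nu_pos. Qed.

Lemma expect_le f g : bounded_meas f -> bounded_meas g ->
  (forall y, 0 < y -> f y <= g y) -> expect f <= expect g.
Proof.
move=> bf bg fg; apply: le_Rintegral => //; try exact: bounded_meas_integrable.
by move=> y /=; rewrite in_itv/= andbT => /fg.
Qed.

Lemma expect_indic b : 0 <= b -> expect (fun y => \1_(`]b, +oo[%classic) y) = survival b.
Proof.
move=> b0; rewrite /expect /Rintegral /survival integral_indic//; congr (fine (nu _)).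
apply/seteqP; split => y /=; rewrite !in_itv/= !andbT; first by case.
by move=> ltby; split => //; exact: le_lt_trans ltby.
Qed.

Lemma survival_ge0 b : 0 <= survival b.
Proof. by rewrite /survival fine_ge0. Qed.

Lemma survival_le1 b : survival b <= 1.
Proof.
by rewrite /survival -lee_fin fineK ?fin_num_measure// probability_le1.
Qed.

Lemma survival_noninc b c : b <= c -> survival c <= survival b.
Proof.
move=> bc; rewrite /survival fine_le ?fin_num_measure//.
by apply: le_measure; rewrite ?inE//; apply: subset_itvr; rewrite bnd_simp.
Qed.

Definition mgf_trunc gamma b : R := expect (fun y => expR (gamma * Num.min y b)).

Lemma bounded_meas_exp_min gamma b :
  bounded_meas (fun y => expR (gamma * Num.min y b)).
Proof.
split.
  apply: measurableT_comp => //; apply: measurable_funM => //.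
  exact: measurable_minr.
exists (expR (`|gamma| * `|b|)) => y y0.
rewrite ger0_norm ?expR_ge0// ler_expR.
have [b0|b0] := leP 0 b; last first.
  rewrite min_r; last by rewrite ltW// (lt_trans b0).
  by rewrite -normrM ler_norm.
rewrite (le_trans (ler_norm _))// normrM ler_wpM2l// ger0_norm; last first.
  by rewrite le_min b0 ltW.
by rewrite ger0_norm// ge_min lexx orbT.
Qed.

(** [u x] is the probability that a geometric sum of independent variables of
    law [nu], each new term being added with probability [rho], exceeds [x].
    The value 1 on the negatives stands for the terms that overshoot [x]. *)
Definition renewal_solution rho u :=
  [/\ forall x, x < 0 -> u x = 1,
      forall x, 0 <= u x <= 1,
      {homo u : x y / x <= y >-> y <= x} &
      forall x, 0 <= x -> u x = rho * expect (fun y => u (x - y))].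

Section comparison.
Variables (rho : R) (u : R -> R).
Hypotheses (rho01 : 0 < rho < 1) (usol : renewal_solution rho u).

Let rho0 : 0 < rho. Proof. by case/andP: rho01. Qed.
Let rho1 : rho < 1. Proof. by case/andP: rho01. Qed.

Let uneg x : x < 0 -> u x = 1. Proof. by case: usol => + _ _ _; apply. Qed.
Let u_ge0 x : 0 <= u x. Proof. by case: usol => _ /(_ x) /andP[]. Qed.
Let u_le1 x : u x <= 1. Proof. by case: usol => _ /(_ x) /andP[]. Qed.
Let u_mono x y : x <= y -> u y <= u x. Proof. by case: usol => _ _ + _; apply. Qed.

Lemma bounded_meas_shift x : bounded_meas (fun y => u (x - y)).
Proof.
split; last by exists 1 => y _; rewrite ger0_norm.
by apply: nondecreasing_measurable => // y z yz; apply: u_mono; rewrite lerB.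
Qed.

Lemma le_of_le_addXn (a b : R) : (forall n, a <= b + rho ^+ n) -> a <= b.
Proof.
move=> H; have cv : b + rho ^+ n @[n --> \oo] --> b + 0.
  apply: cvgD; first exact: cvg_cst.
  by apply: cvg_expr; rewrite ger0_norm// ltW.
rewrite -[b]addr0 -(cvg_lim _ cv)//; apply: limr_ge; first by apply/cvg_ex; eexists; exact: cv.
by apply: nearW.
Qed.

(** The renewal operator multiplies a uniform error by [rho < 1], so the bound
    [u <= F + rho ^+ n] propagates from [n] to [n.+1], starting from [u <= 1].
    As jumps are positive, only the values of [u] at or below [x0] matter: [F] may
    be chosen after [x0]. *)
Lemma comparison_upper (F : R -> R) x0 :
  (forall x, 0 <= x <= x0 -> 0 <= F x) ->
  (forall x e, 0 <= x <= x0 -> 0 <= e ->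
     (forall z, 0 <= z <= x0 -> u z <= F z + e) ->
     exists g, [/\ bounded_meas g,
       forall y, 0 < y -> u (x - y) <= g y + e & rho * expect g <= F x]) ->
  forall x, 0 <= x <= x0 -> u x <= F x.
Proof.
move=> F_ge0 step x xx0; apply: le_of_le_addXn => n.
elim: n x xx0 => [|n IH] x xx0.
  by rewrite expr0 (le_trans (u_le1 x))// lerDr F_ge0.
have e0 : 0 <= rho ^+ n by rewrite exprn_ge0// ltW.
have [g [bg ug gF]] := step x _ xx0 e0 IH.
have x_ge0 : 0 <= x by case/andP: xx0.
case: usol => _ _ _ -> //.
apply: (@le_trans _ _ (rho * expect (fun y => g y + rho ^+ n))).
  rewrite ler_wpM2l ?(ltW rho0)// expect_le//; first exact: bounded_meas_shift.
  by apply: bounded_measD => //; exact: bounded_meas_cst.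
rewrite expectD//; last exact: bounded_meas_cst.
by rewrite expect_cst mulrDr exprS lerD2r.
Qed.

Lemma comparison_lower (F : R -> R) x0 :
  (forall x, 0 <= x <= x0 -> F x <= 1) ->
  (forall x e, 0 <= x <= x0 -> 0 <= e ->
     (forall z, 0 <= z <= x0 -> F z <= u z + e) ->
     exists g, [/\ bounded_meas g,
       forall y, 0 < y -> g y <= u (x - y) + e & F x <= rho * expect g]) ->
  forall x, 0 <= x <= x0 -> F x <= u x.
Proof.
move=> F_le1 step x xx0; apply: le_of_le_addXn => n.
elim: n x xx0 => [|n IH] x xx0.
  by rewrite expr0 (le_trans (F_le1 x xx0))// lerDr.
have e0 : 0 <= rho ^+ n by rewrite exprn_ge0// ltW.
have [g [bg ug gF]] := step x _ xx0 e0 IH.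
have x_ge0 : 0 <= x by case/andP: xx0.
case: usol => _ _ _ -> //.
apply: (le_trans gF).
apply: (@le_trans _ _ (rho * expect (fun y => u (x - y) + rho ^+ n))).
  rewrite ler_wpM2l ?(ltW rho0)// expect_le//.
  by apply: bounded_measD; [exact: bounded_meas_shift|exact: bounded_meas_cst].
rewrite expectD//; [|exact: bounded_meas_shift|exact: bounded_meas_cst].
by rewrite expect_cst mulrDr exprS.
Qed.

(** Lundberg's inequality without exponential moments: from a level at most
    [x0], a jump larger than [x0] overshoots anyway, and there the exponential
    function already exceeds 1, so jumps may be truncated at [x0]. *)
Lemma lundberg_bound gamma x0 : 0 <= gamma -> 0 <= x0 ->
  rho * mgf_trunc gamma x0 <= 1 -> u x0 <= expR (- (gamma * x0)).
Proof.
move=> g0 x00 mgf1.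
apply: (@comparison_upper (fun x => expR (- (gamma * x))) x0); last by rewrite x00 lexx.
  by move=> x _; exact: expR_ge0.
move=> x e /andP[x_ge0 xx0] e0 IH.
exists (fun y => expR (- (gamma * x)) * expR (gamma * Num.min y x0)); split.
- by apply: bounded_measZ; exact: bounded_meas_exp_min.
- move=> y y0; rewrite -expRD -mulrN -mulrDr.
  have [yx|xy] := leP y x.
    rewrite (le_trans (IH _ _))//; first by apply/andP; split; lra.
    rewrite lerD2r ler_expR -mulrN ler_wpM2l//.
    by rewrite min_l ?(le_trans yx)//; lra.
  rewrite uneg; last by lra.
  rewrite -[leLHS]addr0 lerD// -[leLHS]expR0 ler_expR mulr_ge0//.
  by have [] := leP y x0; lra.
- rewrite expectZ; last exact: bounded_meas_exp_min.
  by rewrite mulrCA ler_piMr ?expR_ge0.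
Qed.

(** The lower bound is the probability that some term of the geometric sum
    exceeds [x] on its own; as a constant function it is a subsolution on
    [0, x]. *)
Lemma single_jump_lower x : 0 <= x ->
  rho * survival x / (1 - rho + rho * survival x) <= u x.
Proof.
move=> x0; set H := survival x; set q := _ / _.
have H0 : 0 <= H by exact: survival_ge0.
have den0 : 0 < 1 - rho + rho * H.
  by rewrite ltr_wpDr ?subr_gt0 ?mulr_ge0 ?(ltW rho0).
have qE : q * (1 - rho + rho * H) = rho * H by rewrite divfK// gt_eqF.
have q1 : q <= 1 by rewrite ler_pdivrMr// mul1r lerDr subr_ge0 (ltW rho1).
apply: (@comparison_lower (fun=> q) x); last by rewrite x0 lexx.
  by move=> ? _.
move=> z e /andP[z0 zx] e0 IH.
exists (fun y => q + (1 - q) * \1_(`]x, +oo[%classic) y); split.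
- apply: bounded_measD; first exact: bounded_meas_cst.
  by apply: bounded_measZ; exact: bounded_meas_indic.
- move=> y y0; rewrite indicE.
  have [yz|zy] := leP y z.
    rewrite memNset/=; last by rewrite in_itv/= andbT; apply/negP; lra.
    by rewrite mulr0 addr0 IH//; apply/andP; split; lra.
  rewrite uneg; last by lra.
  case: (_ \in _); rewrite ?mulr1 ?mulr0; lra.
- rewrite expectD; [|exact: bounded_meas_cst|apply: bounded_measZ; exact: bounded_meas_indic].
  rewrite expect_cst expectZ; last exact: bounded_meas_indic.
  rewrite expect_indic// -/H.
  have -> : rho * (q + (1 - q) * H) = rho * H + q - q * (1 - rho + rho * H) by ring.
  by rewrite qE; lra.
Qed.

Definition mean_trunc b : R := expect (fun y => Num.min y b).

Lemma bounded_meas_min b : bounded_meas (fun y => Num.min y b).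
Proof.
split; first exact: measurable_minr.
exists `|b| => y y0; have [yb|] := leP y b; last by [].
by rewrite !ger0_norm//; lra.
Qed.

(** Each jump is credited up to the size [K] only. The shift of [x] by [K] keeps
    the subsolution below 1 after such a truncated jump past 0, hence below [u]
    at the true landing point. *)
Lemma truncated_exponential_lower gamma K x : 0 <= gamma -> 0 <= K -> 0 <= x ->
  1 <= rho * (1 + gamma * mean_trunc K) ->
  expR (- (gamma * (x + K))) <= u x.
Proof.
move=> g0 K0 x0 h1.
apply: (@comparison_lower (fun x => expR (- (gamma * (x + K)))) x); last by rewrite x0 lexx.
  by move=> z /andP[z0 _]; rewrite -expR0 ler_expR oppr_le0 mulr_ge0// addr_ge0.
move=> z e /andP[z0 zx] e0 IH.
exists (fun y => expR (- (gamma * (z + K))) * expR (gamma * Num.min y K)); split.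
- by apply: bounded_measZ; exact: bounded_meas_exp_min.
- move=> y y0; rewrite -expRD -mulrN -mulrDr.
  have [yz|zy] := leP y z.
    rewrite (le_trans _ (IH _ _))//; last by apply/andP; split; lra.
    rewrite ler_expR -mulrN ler_wpM2l//.
    by have [] := leP y K; lra.
  rewrite uneg; last by lra.
  rewrite -[leLHS]addr0 lerD// -[leRHS]expR0 ler_expR mulr_ge0_le0//.
  by have [] := leP y K; lra.
- rewrite expectZ; last exact: bounded_meas_exp_min.
  rewrite mulrCA ler_peMr ?expR_ge0// (le_trans h1)// ler_wpM2l ?(ltW rho0)//.
  have bm := bounded_meas_min K.
  rewrite -[X in X + _](expect_cst 1) -expectZ// -expectD//; last first.
  + by apply: bounded_measZ.
  + exact: bounded_meas_cst.
  apply: expect_le.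
  + by apply: bounded_measD; [exact: bounded_meas_cst|apply: bounded_measZ].
  + exact: bounded_meas_exp_min.
  + by move=> y y0; rewrite expR_ge1Dx.
Qed.

(** A path from 0 past [x0] either makes no jump above [z], which costs
    [expR (- (gamma * x0))]; or makes a jump above [b], which has probability at
    most [rho / (1 - rho) * survival b]; or makes a jump in [(z, b]]. In the last
    case, if the jump occurs while more than [b + z] remains to be covered, more
    than [z] remains after it, and this costs [u z]; otherwise the small jumps
    alone have covered the distance [x0 - b - z], and this costs
    [expR (- (delta * (x0 - b - z)))]. The sum of the corresponding functions of
    the remaining distance is a supersolution. *)
Lemma big_jump_upper gamma delta b z x0 :
  0 <= gamma -> 0 <= delta -> 0 <= z -> z <= b -> b + z <= x0 ->
  rho * mgf_trunc gamma z <= 1 ->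
  rho * mgf_trunc delta z <= (1 + rho) / 2 ->
  u x0 <= rho * mgf_trunc gamma z * expR (- (gamma * x0)) +
    rho / (1 - rho) * (survival b +
      2 * survival z * (u z + expR (- (delta * (x0 - b - z))))).
Proof.
move=> g0 d0 z0 zb bzx0; set M := rho * _ => M1 N1.
have rho1' : 0 < 1 - rho by rewrite subr_gt0.
have Hz0 := survival_ge0 z; have Hb0 := survival_ge0 b.
(* the factor 2 in [K] matches the slack [(1 - rho) / 2] left by [delta] *)
set K := 2 * rho * survival z / (1 - rho).
set B := rho * survival b / (1 - rho).
have K0 : 0 <= K by rewrite !mulr_ge0 ?invr_ge0// ltW.
have B0 : 0 <= B by rewrite !mulr_ge0 ?invr_ge0// ltW.
have KE : K * (1 - rho) = 2 * rho * survival z by rewrite divfK// gt_eqF.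
have BE : B * (1 - rho) = rho * survival b by rewrite divfK// gt_eqF.
have M0 : 0 <= M.
  rewrite mulr_ge0 ?(ltW rho0)//; apply: Rintegral_ge0 => y _; exact: expR_ge0.
pose F x := M * expR (- (gamma * x)) + K * expR (- (delta * (x - b - z))) +
            (B + K * u z).
have -> : M * expR (- (gamma * x0)) + rho / (1 - rho) * (survival b +
      2 * survival z * (u z + expR (- (delta * (x0 - b - z))))) = F x0.
  by rewrite /F /K /B; ring.
have xx : 0 <= x0 by lra.
apply: (@comparison_upper F x0); last by rewrite xx lexx.
  by move=> x _; rewrite /F !addr_ge0// mulr_ge0 ?expR_ge0.
move=> x e /andP[x_ge0 xx0] e0 IH.
pose E1 y := expR (gamma * Num.min y z).
pose E2 y := expR (delta * Num.min y z).
have bE1 : bounded_meas E1 by exact: bounded_meas_exp_min.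
have bE2 : bounded_meas E2 by exact: bounded_meas_exp_min.
pose c1 := expR (- (gamma * x)); pose c2 := K * expR (- (delta * (x - b - z))).
have c10 : 0 <= c1 by exact: expR_ge0.
have c20 : 0 <= c2 by rewrite mulr_ge0// expR_ge0.
(* a jump above [z] costs [near_cost], and [far_cost] more if it is above [b] *)
have [near_cost [far_cost [nc0 fc0 hle hcost]]] : exists s t, [/\ 0 <= s, 0 <= t,
    (forall y, z < y -> u (x - y) <= s + (if b < y then t else 0)) &
    rho * s * survival z + rho * t * survival b
      <= (B + K * u z) * (1 - rho) + c2 * (1 - rho) / 2].
  have [xs|xs] := leP x (b + z).
    exists 1, 0; split => //; first by move=> y _; case: ifP; rewrite addr0 u_le1.
    rewrite !mulr0 mul0r addr0 mulr1.
    have h : K <= c2.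
      rewrite /c2 ler_peMr// -[leLHS]expR0 ler_expR oppr_ge0 mulr_ge0_le0//; lra.
    have h2 : K * (1 - rho) / 2 <= c2 * (1 - rho) / 2.
      by rewrite ler_pM2r// ler_pM2r.
    have h3 : 0 <= (B + K * u z) * (1 - rho).
      by rewrite mulr_ge0 ?(ltW rho1')// addr_ge0// mulr_ge0.
    move: h2; rewrite KE; lra.
  exists (u z), 1; split => //.
    move=> y zy; case: ifPn => [_|]; first by rewrite (le_trans (u_le1 _))// lerDr.
    by rewrite -leNgt addr0 => yb; apply: u_mono; lra.
  have h3 : 0 <= c2 * (1 - rho) / 2.
    by rewrite mulr_ge0// mulr_ge0// (ltW rho1').
  have h4 : 0 <= rho * u z * survival z by rewrite !mulr_ge0// (ltW rho0).
  have -> : (B + K * u z) * (1 - rho) = B * (1 - rho) + u z * (K * (1 - rho)) by ring.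
  rewrite KE BE mulr1; lra.
exists (fun y => c1 * E1 y + c2 * E2 y + (B + K * u z) +
  (near_cost * \1_(`]z, +oo[%classic) y + far_cost * \1_(`]b, +oo[%classic) y)); split.
- apply: bounded_measD; last first.
    by apply: bounded_measD; apply: bounded_measZ; exact: bounded_meas_indic.
  apply: bounded_measD; last exact: bounded_meas_cst.
  by apply: bounded_measD; apply: bounded_measZ.
- move=> y y0.
  have E10 : 0 <= c1 * E1 y by rewrite mulr_ge0// expR_ge0.
  have E20 : 0 <= c2 * E2 y by rewrite mulr_ge0// expR_ge0.
  have BK0 : 0 <= B + K * u z by rewrite addr_ge0// mulr_ge0.
  have i0 : 0 <= near_cost * \1_(`]z, +oo[%classic) y by rewrite mulr_ge0// indicE.
  have j0 : 0 <= far_cost * \1_(`]b, +oo[%classic) y by rewrite mulr_ge0// indicE.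
  have [yz|zy] := leP y z; last first.
    have := hle _ zy; rewrite !indicE mem_set/=; last by rewrite in_itv/= zy.
    case: ifPn => [by_|yb].
      rewrite mem_set/=; last by rewrite in_itv/= by_.
      by lra.
    by rewrite memNset/=; [lra | rewrite in_itv/= (negbTE yb)].
  have [yx|xy] := leP y x.
    have := IH (x - y); rewrite /F => /(_ _)/wrap[]; first by apply/andP; split; lra.
    have -> : E1 y = expR (gamma * y) by rewrite /E1 min_l.
    have -> : E2 y = expR (delta * y) by rewrite /E2 min_l.
    rewrite /c1 /c2 -mulrA -!expRD.
    have -> : - (gamma * x) + gamma * y = - (gamma * (x - y)) by ring.
    have -> : - (delta * (x - b - z)) + delta * y = - (delta * (x - y - b - z)) by ring.
    move=> h.
    have h2 : M * expR (- (gamma * (x - y))) <= expR (- (gamma * (x - y))).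
      by rewrite ler_piMl ?expR_ge0.
    lra.
  rewrite uneg; last by lra.
  have : 1 <= c1 * E1 y.
    rewrite /c1 /E1 min_l// -expRD -[leLHS]expR0 ler_expR -mulrN -mulrDr mulr_ge0//; lra.
  lra.
- rewrite expectD; last first.
  + by apply: bounded_measD; apply: bounded_measZ; exact: bounded_meas_indic.
  + apply: bounded_measD; last exact: bounded_meas_cst.
    by apply: bounded_measD; apply: bounded_measZ.
  rewrite expectD; [|by apply: bounded_measD; apply: bounded_measZ|exact: bounded_meas_cst].
  rewrite expect_cst; rewrite expectD; [|exact: bounded_measZ..].
  rewrite expectD; [|by apply: bounded_measZ; exact: bounded_meas_indic..].
  rewrite !expectZ//; try exact: bounded_meas_indic.
  rewrite !expect_indic//; last exact: le_trans zb.
  rewrite -/(mgf_trunc gamma z) -/(mgf_trunc delta z) /F.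
  have h : c2 * (rho * mgf_trunc delta z) <= c2 * ((1 + rho) / 2) by rewrite ler_wpM2l.
  rewrite -/c2 -/c1.
  have -> : rho * (c1 * mgf_trunc gamma z + c2 * mgf_trunc delta z + (B + K * u z) +
    (near_cost * survival z + far_cost * survival b)) =
    M * c1 + c2 * (rho * mgf_trunc delta z) + rho * (B + K * u z) +
    (rho * near_cost * survival z + rho * far_cost * survival b).
    by rewrite /M; ring.
  have E : c2 * ((1 + rho) / 2) = c2 - c2 * (1 - rho) / 2 by field.
  rewrite E in h.
  lra.
Qed.

End comparison.
End renewal.

(** * Truncated power moments and exponential moments *)

Section elementary.
Context (R : realType).
Implicit Types x y s t : R.

Lemma expR_sub_affine_le s : 0 <= s -> expR s <= 1 + s + s ^+ 2 * expR s.
Proof.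
move=> s0; have h : expR s - 1 <= s * expR s.
  have := expR_ge1Dx (- s); rewrite expRN => h.
  have := ler_wpM2r (expR_ge0 s) h.
  by rewrite mulVf ?gt_eqF ?expR_gt0//; lra.
have h2 := ler_wpM2l s0 h; rewrite expr2 -mulrA; lra.
Qed.

Lemma powR_expR x y : 0 < x -> x `^ y = expR (y * ln x).
Proof. by move=> x0; rewrite /powR gt_eqF. Qed.

(** [s - q * ln s] increases for [s >= q]. *)
Lemma expR_le_powR q s t : 0 < q -> q <= s -> s <= t ->
  expR s <= expR t * s `^ q * t `^ (- q).
Proof.
move=> q0 qs st; have s0 : 0 < s by exact: lt_le_trans qs.
have t0 : 0 < t by exact: lt_le_trans st.
rewrite !powR_expR// -!expRD ler_expR.
have h : q * (ln t - ln s) <= t - s.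
  rewrite -ln_div ?posrE//.
  have h1 : ln (t / s) <= t / s - 1.
    have := @le_ln1Dx R (t / s - 1); rewrite addrCA subrr addr0; apply.
    by rewrite ltrBrDr addrC subrr divr_gt0.
  apply: (le_trans (ler_wpM2l (ltW q0) h1)).
  have -> : t - s = s * (t / s - 1) by field; rewrite gt_eqF.
  by rewrite ler_wpM2r// subr_ge0 ler_pdivlMr// mul1r.
lra.
Qed.

Lemma sqr_le_powR p q s : 0 < p <= 1 -> 1 <= q -> 0 <= s <= q ->
  s ^+ 2 <= q * s `^ (1 + p).
Proof.
move=> /andP[p0 p1] q1 /andP[s0 sq].
have [->|sn0] := eqVneq s 0.
  by rewrite expr0n/= mulr_ge0 ?powR_ge0//; lra.
have sp : 0 < s by rewrite lt_neqAle eq_sym sn0.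
have -> : s ^+ 2 = s `^ (1 - p) * s `^ (1 + p).
  rewrite -powRD; last by rewrite sn0 implybT.
  by rewrite -powR_mulrn//; congr (_ `^ _); ring.
rewrite ler_wpM2r ?powR_ge0//.
have [s1|s1] := leP s 1; last first.
  by rewrite (le_trans _ sq)// ler1_powR//; lra.
rewrite (le_trans _ q1)// -[leRHS](powRr0 s) ger_powR ?sp ?s1//; lra.
Qed.

(** The Taylor remainder of [expR s] at first order is at most
    [s ^+ 2 * expR s], hence of order [s `^ (1 + p)] for [s <= q]. Beyond [q],
    [expR s * s `^ (- q)] increases, so its value at the right end point
    [gamma * b] takes over. *)
Lemma expR_le_truncated p q gamma b y : 0 < p <= 1 -> 1 <= q ->
    0 <= gamma -> 0 < b -> 0 <= y <= b ->
  expR (gamma * y) <= 1 + gamma * y + q * expR q * gamma `^ (1 + p) * y `^ (1 + p)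
    + expR (gamma * b) * b `^ (- q) * y `^ q.
Proof.
move=> p01 q1 g0 b0 /andP[y0 yb]; have q0 : 0 < q by lra.
have gy0 : 0 <= gamma * y by rewrite mulr_ge0.
have nn1 : 0 <= q * expR q * gamma `^ (1 + p) * y `^ (1 + p).
  by rewrite !mulr_ge0 ?powR_ge0 ?expR_ge0// ltW.
have nn2 : 0 <= expR (gamma * b) * b `^ (- q) * y `^ q.
  by rewrite !mulr_ge0 ?powR_ge0 ?expR_ge0.
have [sq|qs] := leP (gamma * y) q.
  have := expR_sub_affine_le gy0.
  have : (gamma * y) ^+ 2 * expR (gamma * y) <=
         q * expR q * gamma `^ (1 + p) * y `^ (1 + p).
    rewrite -[leRHS]mulrA -powRM// [leRHS]mulrAC ler_pM ?expR_ge0 ?sqr_ge0//.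
      by apply: sqr_le_powR; rewrite // gy0.
    by rewrite ler_expR.
  lra.
have gp : 0 < gamma.
  rewrite lt_neqAle g0 andbT eq_sym; apply/eqP => g00.
  by move: qs; rewrite g00 mul0r; lra.
have := expR_le_powR q0 (ltW qs) (ler_wpM2l g0 yb).
have -> : expR (gamma * b) * (gamma * y) `^ q * (gamma * b) `^ (- q) =
          expR (gamma * b) * b `^ (- q) * y `^ q.
  rewrite !powRM ?(ltW b0)//; rewrite [gamma `^ (- q)]powRN.
  by field; rewrite gt_eqF ?powR_gt0.
lra.
Qed.

End elementary.

Section truncated_moments.
Context (R : realType) (nu : probability R R).
Hypothesis nu_pos : nu `]0, +oo[%classic = 1%E.
Implicit Types (q b y r : R).

Lemma bounded_meas_powR_min q b : 0 <= q -> 0 <= b ->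
  bounded_meas (fun y => Num.min y b `^ q).
Proof.
move=> q0 b0; split.
  apply: (@measurableT_comp _ _ _ _ _ _ (fun x : R => x `^ q) _ (fun y => Num.min y b)); first exact: measurable_powR.
  exact: measurable_minr.
exists (b `^ q) => y y0; have m0 : 0 <= Num.min y b by rewrite le_min b0 ltW.
by rewrite ger0_norm ?powR_ge0// ge0_ler_powR ?nnegrE// ge_min lexx orbT.
Qed.

(** Dyadic decomposition: values between [2 ^+ k] and [2 ^+ k.+1] contribute at
    most [2 `^ (q * k.+1) * survival nu (2 ^+ k)], the general term of a
    convergent geometric series. *)
Lemma moment_trunc_bound r q (C : R) : 0 <= C -> 0 <= q -> q < r ->
  (forall y, 1 <= y -> survival nu y <= C * y `^ (- r)) ->
  exists2 M, 0 <= M &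
    forall b, 0 <= b -> expect nu (fun y => Num.min y b `^ q) <= M.
Proof.
move=> C0 q0 qr HC; pose t : R := 2 `^ (q - r).
have t0 : 0 < t by rewrite powR_gt0.
have t1 : t < 1.
  by rewrite /t powR_expR// expR_lt1 nmulr_rlt0 ?subr_lt0// ln_gt0// ?ltr1n.
have step n b : 0 <= b -> b <= 2 ^+ n ->
    expect nu (fun y => Num.min y b `^ q) <= 1 + C * 2 `^ q * \sum_(k < n) t ^+ k.
  elim: n b => [|n IH] b b0 bn.
    rewrite big_ord0 mulr0 addr0 -[leRHS](expect_cst nu_pos).
    apply: expect_le => //; [exact: bounded_meas_powR_min|exact: bounded_meas_cst|].
    move=> y y0; have -> : 1 = 1 `^ q :> R by rewrite powR1.
    rewrite ge0_ler_powR ?nnegrE//.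
      by rewrite le_min b0 ltW.
    by rewrite ge_min (le_trans bn) ?orbT// expr0.
  pose b' := Num.min b (2 ^+ n).
  have b'0 : 0 <= b' by rewrite le_min b0 exprn_ge0.
  have b'n : b' <= 2 ^+ n by rewrite ge_min lexx orbT.
  have c0 : 0 <= (2 ^+ n.+1 : R) `^ q by exact: powR_ge0.
  have n1 : 1 <= 2 ^+ n :> R by rewrite exprn_ege1// ler1n.
  apply: (@le_trans _ _ (expect nu (fun y => Num.min y b' `^ q +
      (2 ^+ n.+1) `^ q * \1_(`]2 ^+ n, +oo[%classic) y))).
    apply: expect_le => //; first exact: bounded_meas_powR_min.
      apply: bounded_measD; first exact: bounded_meas_powR_min.
      by apply: bounded_measZ; exact: bounded_meas_indic.
    move=> y y0; rewrite indicE; have [yn|yn] := leP y (2 ^+ n).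
      rewrite memNset/=; last by rewrite in_itv/= andbT ltNge yn.
      rewrite mulr0 addr0 /b'.
      suff -> : Num.min y (Num.min b (2 ^+ n)) = Num.min y b by [].
      rewrite minA; apply: min_l.
      by rewrite ge_min yn.
    rewrite mem_set/= ?in_itv/= ?yn// mulr1 ler_wpDl ?powR_ge0//.
    rewrite ge0_ler_powR ?nnegrE//.
    - by rewrite le_min b0 ltW.
    - by rewrite ge_min bn orbT.
  rewrite expectD//; last 2 first.
  - exact: bounded_meas_powR_min.
  - by apply: bounded_measZ; exact: bounded_meas_indic.
  rewrite expectZ//; last exact: bounded_meas_indic.
  rewrite expect_indic ?exprn_ge0// big_ord_recr/= mulrDr addrA lerD ?IH//.
  apply: (le_trans (ler_wpM2l c0 (HC _ n1))).
  rewrite le_eqVlt; apply/orP; left; apply/eqP.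
  rewrite /t exprS powRM ?exprn_ge0// -!powR_mulrn ?powR_ge0//.
  rewrite -!powRrM mulrCA -!mulrA; congr (_ * (_ * _)).
  by rewrite -powRD ?pnatr_eq0 ?implybT//; congr (_ `^ _); ring.
exists (1 + C * 2 `^ q / (1 - t)).
  by rewrite addr_ge0// !mulr_ge0 ?powR_ge0// invr_ge0 subr_ge0 ltW.
move=> b b0; have [n bn] : exists n : nat, b <= 2 ^+ n.
  exists (Num.truncn b).+1; apply: (@le_trans _ _ (Num.truncn b).+1%:R).
    by rewrite ltW// truncnS_gt.
  by rewrite -natrX ler_nat ltnW// ltn_expl.
apply: (le_trans (step n b b0 bn)); rewrite lerD2l ler_wpM2l ?mulr_ge0 ?powR_ge0//.
rewrite -[leRHS]mul1r ler_pdivlMr ?subr_gt0//.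
rewrite mulrC -opprB mulNr -subrX1 opprB gerBl exprn_ge0// ltW//.
Qed.

(** [expR_le_truncated] with [q = 1 + s], integrated: the two power moments that
    appear are bounded uniformly in the truncation level. *)
Lemma mgf_trunc_bound r s p (C0 : R) : 0 < s -> 0 < p <= 1 -> p <= s -> 1 + s < r ->
  0 <= C0 -> (forall y, 1 <= y -> survival nu y <= C0 * y `^ (- r)) ->
  exists2 C, 0 <= C & forall gamma b, 0 <= gamma -> 0 < b ->
    mgf_trunc nu gamma b <= 1 + gamma * mean_trunc nu b
      + C * gamma `^ (1 + p) + C * expR (gamma * b) * b `^ (- (1 + s)).
Proof.
move=> s0 p01 ps sr C00 HC; have /andP[p0 p1] := p01.
have q0 : 0 <= 1 + s by lra.
have q'0 : 0 <= 1 + p by lra.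
have p_r : 1 + p < r by lra.
have [M M0 HM] := moment_trunc_bound C00 q0 sr HC.
have [N N0 HN] := moment_trunc_bound C00 q'0 p_r HC.
pose q := 1 + s; pose c := q * expR q.
have c0 : 0 <= c by rewrite mulr_ge0// expR_ge0.
exists (M + c * N); first by rewrite addr_ge0// mulr_ge0.
move=> gamma b g0 b0; have b0' := ltW b0.
pose c1 := c * gamma `^ (1 + p); pose c2 := expR (gamma * b) * b `^ (- q).
have c10 : 0 <= c1 by rewrite mulr_ge0// powR_ge0.
have c20 : 0 <= c2 by rewrite mulr_ge0 ?expR_ge0// powR_ge0.
have bm1 := bounded_meas_min b.
have bm2 := bounded_meas_powR_min q'0 b0'.
have bm3 := bounded_meas_powR_min q0 b0'.
have bmc : bounded_meas (fun=> 1 : R) by exact: bounded_meas_cst.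
apply: (@le_trans _ _ (expect nu (fun y => (1 + gamma * Num.min y b) +
   (c1 * Num.min y b `^ (1 + p) + c2 * Num.min y b `^ q)))).
  apply: expect_le => //; first exact: bounded_meas_exp_min.
    by apply: bounded_measD; apply: bounded_measD => //; apply: bounded_measZ.
  move=> y y0; rewrite addrA.
  apply: expR_le_truncated => //; first by rewrite /q; lra.
  by rewrite le_min b0' (ltW y0)/= ge_min lexx orbT.
rewrite expectD//; [|by apply: bounded_measD => //; apply: bounded_measZ..].
rewrite expectD//; last exact: bounded_measZ.
rewrite expectD//; [|exact: bounded_measZ..].
rewrite expect_cst// !expectZ// -/(mean_trunc nu b) -[leRHS]addrA lerD2l.
rewrite lerD//.
  rewrite /c1 mulrAC ler_wpM2r ?powR_ge0//.
  by rewrite (le_trans (ler_wpM2l c0 (HN _ b0')))// lerDr.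
rewrite -/c2 -[leRHS]mulrA -/c2 mulrC ler_wpM2r//.
by rewrite (le_trans (HM _ b0'))// lerDl mulr_ge0.
Qed.

End truncated_moments.

Section mean.
Context (R : realType) (nu : probability R R).
Hypothesis nu_pos : nu `]0, +oo[%classic = 1%E.
Implicit Types (q b y r : R).

Lemma mean_trunc_homo b c : b <= c -> mean_trunc nu b <= mean_trunc nu c.
Proof.
move=> bc; apply: expect_le => //; try exact: bounded_meas_min.
by move=> y y0; rewrite le_min !ge_min lexx bc/= orbT.
Qed.

Lemma mean_trunc_EFin b :
  (\int[nu]_(y in `]0%R, +oo[) (Num.min y b)%:E = (mean_trunc nu b)%:E)%E.
Proof.
rewrite fineK//; apply: integrable_fin_num => //.
by apply: bounded_meas_integrable => //; exact: bounded_meas_min.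
Qed.

Lemma mean_trunc_gt0 b : 0 < b -> 0 < survival nu b -> 0 < mean_trunc nu b.
Proof.
move=> b0 Hb; apply: (@lt_le_trans _ _ (b * survival nu b)); first exact: mulr_gt0.
rewrite -expect_indic ?(ltW b0)// -expectZ//; last exact: bounded_meas_indic.
apply: expect_le => //.
- by apply: bounded_measZ; exact: bounded_meas_indic.
- exact: bounded_meas_min.
move=> y y0; rewrite indicE; case: (boolP (y \in _)) => [|_]; last first.
  by rewrite mulr0 le_min !ltW.
rewrite inE/= in_itv/= andbT => yb.
by rewrite mulr1 le_min lexx andbT ltW.
Qed.

(** The truncated means increase to the mean. Truncating at [K] instead of
    [b] changes [Num.min y b] only where it exceeds [K], by at most
    [Num.min y b `^ (1 + s) * K `^ (- s)]. *)
Lemma mean_exists r s (C : R) : 0 < survival nu 1 -> 0 <= C -> 0 < s -> 1 + s < r ->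
  (forall y, 1 <= y -> survival nu y <= C * y `^ (- r)) ->
  exists mu M, [/\ 0 < mu, 0 <= M,
    (\int[nu]_(y in `]0%R, +oo[) y%:E = mu%:E)%E,
    forall b, mean_trunc nu b <= mu &
    forall K, 0 < K -> mu <= mean_trunc nu K + M * K `^ (- s)].
Proof.
move=> H1 C0 s0 sr HC; have q0 : 0 <= 1 + s by lra.
have [M M0 HM] := moment_trunc_bound nu_pos C0 q0 sr HC.
have gap K b : 0 < K -> 0 <= b ->
    mean_trunc nu b <= mean_trunc nu K + M * K `^ (- s).
  move=> K0 b0; have bm := bounded_meas_powR_min q0 b0.
  apply: (@le_trans _ _ (expect nu (fun y => Num.min y K +
      K `^ (- s) * Num.min y b `^ (1 + s)))).
    apply: expect_le => //; first exact: bounded_meas_min.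
      by apply: bounded_measD; [exact: bounded_meas_min|exact: bounded_measZ].
    move=> y y0; have m0 : 0 <= Num.min y b by rewrite le_min b0 ltW.
    have [mK|Km] := leP (Num.min y b) K.
      rewrite ler_wpDr ?mulr_ge0 ?powR_ge0// le_min mK.
      by rewrite ge_min lexx.
    rewrite ler_wpDl// ?le_min ?(ltW y0) ?(ltW K0)//.
    have mp : 0 < Num.min y b by exact: lt_trans Km.
    rewrite mulrC powRD; last by rewrite (gt_eqF mp) implybT.
    rewrite powRr1// -mulrA ler_peMr//.
    rewrite powRN ler_pdivlMr ?powR_gt0// mul1r ge0_ler_powR ?nnegrE ?ltW//.
  rewrite expectD//; [|exact: bounded_meas_min|exact: bounded_measZ].
  rewrite expectZ// lerD2l mulrC ler_wpM2r ?powR_ge0//.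
  exact: HM.
pose g (n : nat) (y : R) : \bar R := (Num.min y n%:R)%:E.
pose D : set R := `]0, +oo[%classic.
have mono (y : R) : D y -> nondecreasing_seq (g^~ y).
  move=> _ m n mn; rewrite /g lee_fin le_min !ge_min lexx/=.
  by rewrite ler_nat mn orbT.
have g0 n y : D y -> (0 <= g n y)%E.
  by rewrite /D/= in_itv/= andbT => y0; rewrite lee_fin le_min ler0n ltW.
have mg n : measurable_fun D (g n).
  apply/measurable_EFinP; apply: measurable_minr => //.
have := @cvg_monotone_convergence _ _ _ nu D (measurable_itv _) g mg g0 mono.
have -> : (\int[nu]_(x in D) (fun y => limn (g ^~ y)) x =
           \int[nu]_(x in D) x%:E)%E.
  apply: eq_integral => y; rewrite inE /D/= in_itv/= andbT => y0.
  apply/cvg_lim => //; apply: cvg_near_cst.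
  near=> n; rewrite /g; congr EFin; apply: min_l.
  by near: n; exact: nbhs_infty_ger.
under eq_cvg do rewrite /g mean_trunc_EFin.
move=> cv.
have up (K : R) : 0 < K -> (\int[nu]_(x in D) x%:E <=
    (mean_trunc nu K + M * K `^ (- s))%:E)%E.
  move=> K0; rewrite -(cvg_lim _ cv)//; apply: lime_le.
    by apply/cvg_ex; eexists; exact: cv.
  by apply: nearW => n; rewrite lee_fin gap.
have low (b : R) : ((mean_trunc nu b)%:E <= \int[nu]_(x in D) x%:E)%E.
  rewrite -(cvg_lim _ cv)//; apply: lime_ge.
    by apply/cvg_ex; eexists; exact: cv.
  near=> n; rewrite lee_fin mean_trunc_homo//.
  by near: n; exact: nbhs_infty_ger.
pose mu := fine (\int[nu]_(x in D) x%:E)%E.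
have muE : (\int[nu]_(x in D) x%:E)%E = mu%:E.
  rewrite fineK// ge0_fin_numE; first by rewrite (le_lt_trans (up 1 ltr01)) ?ltry.
  by apply: integral_ge0 => y; rewrite /D/= in_itv/= andbT => y0; rewrite lee_fin ltW.
rewrite muE in up, low.
exists mu, M; split => //.
by rewrite (lt_le_trans (mean_trunc_gt0 ltr01 H1))// -lee_fin low.
Unshelve. all: by end_near. Qed.

End mean.

(** * Affine change of variable for the Lebesgue measure *)

Section affine_change_of_variable.
Context (R : realType).
Local Notation mu := (@lebesgue_measure R).
Local Open Scope ereal_scope.

Lemma measurable_affine (a b : R) :
  measurable_fun [set: R] (fun t : R => a * t + b : measurableTypeR R)%R.
Proof. by apply: measurable_funD => //; exact: measurable_funM. Qed.

Lemma preimage_affine_itv (a b : R) (i j : itv_bound R) : (0 < a)%R ->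
  (fun t : R => a * t + b)%R @^-1` [set` Interval i j] =
  [set` Interval (map_itv_bound (fun s => (s - b) / a)%R i)
                 (map_itv_bound (fun s => (s - b) / a)%R j)].
Proof.
move=> a0; apply/seteqP; split => t /=; rewrite !itv_boundlr.
  by case: i j => [[] x|[]] [[] y|[]] //=; rewrite !bnd_simp
     ?ler_pdivrMr ?ler_pdivlMr ?ltr_pdivrMr ?ltr_pdivlMr// ?lerBlDr ?lerBrDr
     ?ltrBlDr ?ltrBrDr ?(mulrC t).
by case: i j => [[] x|[]] [[] y|[]] //=; rewrite !bnd_simp
     ?ler_pdivrMr ?ler_pdivlMr ?ltr_pdivrMr ?ltr_pdivlMr// ?lerBlDr ?lerBrDr
     ?ltrBlDr ?ltrBrDr ?(mulrC t).
Qed.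

(** Both sides are measures, and they agree on half-open intervals. *)
Lemma lebesgue_measure_affine (a b : R) (A : set R) : (0 < a)%R -> measurable A ->
  mu A = a%:E * mu ((fun t : R => a * t + b)%R @^-1` A).
Proof.
move=> a0 mA.
pose phi (t : R) : measurableTypeR R := (a * t + b)%R.
have mphi : measurable_fun [set: measurableTypeR R] phi by exact: measurable_affine.
pose mphi_mixin := isMeasurableFun.Build _ _ _ _ _ mphi.
pose Phi : {mfun (measurableTypeR R) >-> (measurableTypeR R)} := HB.pack phi mphi_mixin.
pose k : {nonneg R} := NngNum (ltW a0).
rewrite (@lebesgue_measure_unique R (mscale k (pushforward mu Phi)))//.
move=> _ [[x y] _ <-]; rewrite /mscale/= /pushforward/=.
have E := @preimage_affine_itv a b (BRight x) (BRight y) a0.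
rewrite [X in _ = _ * lebesgue_measure X]E/=.
rewrite !lebesgue_measure_itv/= !lte_fin ltr_pM2r ?invr_gt0// ltrD2r.
case: ifPn => _; last by rewrite mule0.
by rewrite -!EFinB -EFinM; congr EFin; field; rewrite gt_eqF.
Qed.

Lemma integral_affine (a b : R) (D : set R) (f : R -> \bar R) : (0 < a)%R ->
  measurable D -> measurable_fun D f -> (forall y, D y -> 0 <= f y) ->
  \int[mu]_(y in D) f y =
  a%:E * \int[mu]_(t in (fun t : R => a * t + b)%R @^-1` D) f (a * t + b)%R.
Proof.
move=> a0 mD mf f0.
pose phi (t : R) : measurableTypeR R := (a * t + b)%R.
have mphi : measurable_fun [set: measurableTypeR R] phi by exact: measurable_affine.
pose mphi_mixin := isMeasurableFun.Build _ _ _ _ _ mphi.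
pose Phi : {mfun (measurableTypeR R) >-> (measurableTypeR R)} := HB.pack phi mphi_mixin.
pose k : {nonneg R} := NngNum (ltW a0).
rewrite (eq_measure_integral (mscale k (pushforward mu Phi))); last first.
  by move=> A mA _; exact: (lebesgue_measure_affine b a0 mA).
rewrite ge0_integral_mscale//= ge0_integral_pushforward//.
by move=> y /set_mem; exact: f0.
Qed.

End affine_change_of_variable.

(** * Regular variation of a tail and of its integral *)

Section regular_variation.
Context (R : realType).
Implicit Types (x y t r l e alpha beta : R) (h L : R -> R).

Definition regularly_varying h beta :=
  forall l, 0 < l -> h (l * x) / h x @[x --> +oo] --> l `^ beta.

Lemma near_pinfty_ge (P : R -> Prop) :
  (\forall x \near +oo, P x) -> \forall x \near +oo, forall t, x <= t -> P t.
Proof.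
move=> [M [Mr HM]]; exists M; split => // x Mx t xt.
by apply: HM; exact: lt_le_trans xt.
Qed.

Lemma near_scale (P : R -> Prop) l : 0 < l ->
  (\forall x \near +oo, P x) -> \forall x \near +oo, P (l * x).
Proof.
move=> l0 HP; have c : l * x @[x --> +oo] --> +oo by exact: gt0_cvgMry.
exact: c.
Qed.

(** The slowly varying factor disappears from the ratio of two values. *)
Lemma asymp_equiv_regularly_varying h L alpha :
  (forall t, 0 < t -> L (t * x) / L x @[x --> +oo] --> (1 : R)) ->
  (\forall x \near +oo, 0 < L x) -> (forall x, 0 < h x) ->
  asymp_equiv h (fun x => L x * x `^ (- alpha)) ->
  regularly_varying h (- alpha).
Proof.
move=> Ls Lp hp hL l l0.
have c1 : h (l * x) / (L (l * x) * (l * x) `^ (- alpha)) @[x --> +oo] --> (1 : R).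
  have cl : l * x @[x --> +oo] --> +oo by exact: gt0_cvgMry.
  exact: (cvg_comp _ _ cl hL).
have c2 := Ls l l0.
have c3 : (h x / (L x * x `^ (- alpha)))^-1 @[x --> +oo] --> (1 : R)^-1.
  by apply: cvgV; rewrite ?oner_neq0.
have : (h (l * x) / (L (l * x) * (l * x) `^ (- alpha))) * (L (l * x) / L x) *
   ((h x / (L x * x `^ (- alpha)))^-1) * l `^ (- alpha) @[x --> +oo] -->
   (1 : R) * 1 * 1^-1 * l `^ (- alpha).
  by apply: cvgM; [apply: cvgM => //; exact: cvgM|exact: cvg_cst].
rewrite invr1 !mul1r; apply: cvg_trans; apply: near_eq_cvg; near=> x.
have x0 : 0 < x by near: x; exact: nbhs_pinfty_gt.
have Lx : 0 < L x by near: x.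
have Llx : 0 < L (l * x) by near: x; exact: (@near_scale (fun x => 0 < L x) l l0 Lp).
rewrite powRM ?(ltW l0) ?(ltW x0)//; field.
by rewrite !gt_eqF// powR_gt0.
Unshelve. all: by end_near. Qed.

Lemma dyadic_propagation (P : R -> Prop) x0 : 0 < x0 ->
  (forall y, x0 <= y <= 2 * x0 -> P y) ->
  (forall y, x0 <= y -> P y -> P (2 * y)) ->
  forall y, x0 <= y -> P y.
Proof.
move=> x00 base step.
have H n : forall y, x0 <= y <= 2 ^+ n * x0 -> P y.
  elim: n => [|n IH] y /andP[xy yn].
    by apply: base; rewrite xy/= (le_trans yn)// expr0 ler_wpM2r ?(ltW x00)// ler1n.
  have [y2|y2] := leP y (2 * x0); first by apply: base; rewrite xy.
  have -> : y = 2 * (y / 2) by field.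
  have xy2 : x0 <= y / 2 by rewrite ler_pdivlMr// mulrC ltW.
  apply: step => //; apply: IH; rewrite xy2/= ler_pdivrMr//.
  by rewrite mulrAC -exprSr.
move=> y xy; apply: (H (Num.truncn (y / x0)).+1); rewrite xy/= -ler_pdivrMr//.
apply: (@le_trans _ _ (Num.truncn (y / x0)).+1%:R); first by rewrite ltW// truncnS_gt.
by rewrite -natrX ler_nat ltnW// ltn_expl.
Qed.

(** Far out, doubling the argument divides [h] by nearly [2 `^ beta], hence by
    more than [2 `^ r]; this is iterated along dyadic multiples. *)
Lemma potter_upper h beta r : 0 < r < beta ->
  {homo h : x y / x <= y >-> y <= x} -> (forall x, 0 < h x) -> (forall x, h x <= 1) ->
  regularly_varying h (- beta) ->
  exists2 C, 0 <= C & forall y, 1 <= y -> h y <= C * y `^ (- r).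
Proof.
move=> /andP[r0 rb] hmono hp h1 rv.
have lt2 : 2 `^ (- beta) < 2 `^ (- r) :> R.
  rewrite /powR gt_eqF// ltr_expR ltr_pM2r ?ln_gt0 ?ltr1n//; lra.
have [M [_ HM]] : \forall x \near +oo, h (2 * x) / h x < 2 `^ (- r).
  by have := rv 2 (ltr0n _ 2); move/cvgr_lt; apply.
pose x0 := Num.max 1 (M + 1).
have x01 : 1 <= x0 by rewrite le_max lexx.
have x00 : 0 < x0 by rewrite (lt_le_trans ltr01).
have Mx0 : M < x0 by rewrite lt_max ltrDl ltr01 orbT.
have bnd y : 1 <= y <= 2 * x0 -> h y <= (2 * x0) `^ r * y `^ (- r).
  move=> /andP[y1 y2]; have y0 : 0 < y by rewrite (lt_le_trans ltr01).
  rewrite (le_trans (h1 y))// powRN ler_pdivlMr ?powR_gt0// mul1r.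
  by rewrite ge0_ler_powR ?nnegrE ?mulr_ge0 ?(ltW r0) ?(ltW y0) ?(ltW x00).
exists ((2 * x0) `^ r); first exact: powR_ge0.
move=> y y1; have [yx0|x0y] := leP y (2 * x0); first by apply: bnd; rewrite y1.
have := @dyadic_propagation (fun y => h y <= (2 * x0) `^ r * y `^ (- r)) x0 x00.
apply; last by lra.
  by move=> z /andP[z1 z2]; apply: bnd; rewrite z2 andbT (le_trans x01).
move=> z xz IH; have z0 : 0 < z by rewrite (lt_le_trans x00).
have := HM z (lt_le_trans Mx0 xz); rewrite ltr_pdivrMr// => /ltW/le_trans; apply.
by rewrite powRM ?(ltW z0)// mulrCA ler_wpM2l ?powR_ge0.
Qed.

Lemma potter_lower h beta r : 0 < beta < r ->
  {homo h : x y / x <= y >-> y <= x} -> (forall x, 0 < h x) ->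
  regularly_varying h (- beta) ->
  exists2 c, 0 < c & \forall y \near +oo, c * y `^ (- r) <= h y.
Proof.
move=> /andP[b0 rb] hmono hp rv; have r0 : 0 < r by lra.
have lt2 : 2 `^ (- r) < 2 `^ (- beta) :> R.
  rewrite /powR gt_eqF// ltr_expR ltr_pM2r ?ln_gt0 ?ltr1n//; lra.
have [M [_ HM]] : \forall x \near +oo, 2 `^ (- r) < h (2 * x) / h x.
  by have := rv 2 (ltr0n _ 2); move/cvgr_gt; apply.
pose x0 := Num.max 1 (M + 1).
have x01 : 1 <= x0 by rewrite le_max lexx.
have x00 : 0 < x0 by rewrite (lt_le_trans ltr01).
have Mx0 : M < x0 by rewrite lt_max ltrDl ltr01 orbT.
exists (h (2 * x0) * x0 `^ r); first by rewrite mulr_gt0// powR_gt0.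
exists x0; split; first exact: num_real.
move=> y /ltW; move: y.
apply: (@dyadic_propagation (fun y => h (2 * x0) * x0 `^ r * y `^ (- r) <= h y) x0 x00).
  move=> y /andP[y1 y2]; apply: (le_trans _ (hmono _ _ y2)).
  have y0 : 0 < y by rewrite (lt_le_trans x00).
  rewrite -mulrA ler_piMr ?(ltW (hp _))// powRN ler_pdivrMr ?powR_gt0// mul1r.
  by rewrite ge0_ler_powR ?nnegrE ?(ltW r0) ?(ltW y0) ?(ltW x00).
move=> z xz IH; have z0 : 0 < z by rewrite (lt_le_trans x00).
have := HM z (lt_le_trans Mx0 xz); rewrite ltr_pdivlMr// => /ltW; apply: le_trans.
by rewrite powRM ?(ltW z0)// mulrCA ler_wpM2l ?powR_ge0.
Qed.

End regular_variation.

Section integrated_tail.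
Context (R : realType) (Vb H : R -> R) (m alpha : R).
Hypotheses (m0 : 0 < m) (alpha1 : 1 < alpha).
Hypotheses (Vb_homo : {homo Vb : x y / x <= y >-> y <= x})
  (Vb_gt0 : forall x, 0 < Vb x) (Vb_rv : regularly_varying Vb (- alpha)).
Hypothesis HE : forall x, 0 <= x ->
  (\int[lebesgue_measure]_(y in `]x, +oo[) (Vb y / m)%:E = (H x)%:E)%E.
Implicit Types (x y t e l : R).

Let mVb (D : set R) (a : R) : 0 < a -> measurable D ->
  measurable_fun D (fun y => (Vb (a * y) / m)%:E).
Proof.
move=> a0 mD; apply/measurable_EFinP; apply: measurable_funM => //.
apply: (measurable_funS measurableT) => //.
apply: nonincreasing_measurable => // y z yz; apply: Vb_homo.
by rewrite ler_wpM2l// ltW.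
Qed.

Let Vbm0 a y : 0 <= Vb (a * y) / m.
Proof. by rewrite divr_ge0 ?ltW. Qed.

Let mVb1 (D : set R) : measurable D -> measurable_fun D (fun y => (Vb y / m)%:E).
Proof.
move=> mD; have h := mVb ltr01 mD.
by under eq_fun do rewrite -[X in Vb X]mul1r.
Qed.

Lemma integrated_tail_scale x l : 0 <= x -> 0 < l ->
  (\int[lebesgue_measure]_(y in `]x, +oo[) (Vb (l * y) / m)%:E =
   (H (l * x) / l)%:E)%E.
Proof.
move=> x0 l0; have h := HE (mulr_ge0 (ltW l0) x0).
rewrite (integral_affine 0 l0)// in h; last 2 first.
- exact: mVb1.
- by move=> y _; rewrite lee_fin divr_ge0 ?ltW.
have E := @preimage_affine_itv R l 0 (BRight (l * x)) +oo%O l0.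
rewrite [X in (\int[lebesgue_measure]_(t in X) _)%E]E/= in h.
rewrite subr0 mulrAC divff ?gt_eqF// mul1r in h.
rewrite mulrC EFinM -h muleA -EFinM mulVf ?gt_eqF// mul1e.
by apply: eq_integral => y _; rewrite addr0.
Qed.

Lemma integrated_tail_split x z : 0 <= x -> x <= z ->
  H z + (z - x) * (Vb z / m) <= H x <= H z + (z - x) * (Vb x / m).
Proof.
move=> x0 xz; have z0 : 0 <= z by exact: le_trans xz.
have hU : `]x, +oo[%classic = `]x, z]%classic `|` `]z, +oo[%classic :> set R.
  by rewrite -itv_bndbnd_setU// bnd_simp.
have hx := HE x0; rewrite hU ge0_integral_setU//= in hx; last 3 first.
- by apply: mVb1; exact: measurableU.
- by move=> y _; rewrite lee_fin divr_ge0 ?ltW.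
- apply/disj_setPLR => y/=; rewrite !in_itv/= andbT => /andP[_].
  by rewrite leNgt => /negP.
rewrite HE// in hx.
have cstE c : (\int[lebesgue_measure]_(y in `]x, z]) c%:E = ((z - x) * c)%:E :> \bar R)%E.
  rewrite integral_cst//= lebesgue_measure_itv/= lte_fin mulrC EFinM.
  have [_|zx] := ltP x z; first by rewrite EFinB.
  have -> : z - x = 0 by apply/eqP; rewrite subr_eq0; apply/eqP/le_anti; rewrite zx.
  by [].
have b1 : (((z - x) * (Vb z / m))%:E <=
    \int[lebesgue_measure]_(y in `]x, z]) (Vb y / m)%:E)%E.
  rewrite -cstE; apply: ge0_le_integral => //=.
  - by move=> y _; rewrite lee_fin divr_ge0 ?ltW.
  - exact: mVb1.
  - move=> y; rewrite in_itv/= => /andP[_ yz].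
    by rewrite lee_fin ler_pM2r ?invr_gt0// Vb_homo.
have b2 : (\int[lebesgue_measure]_(y in `]x, z]) (Vb y / m)%:E <=
    ((z - x) * (Vb x / m))%:E)%E.
  rewrite -cstE; apply: ge0_le_integral => //=.
  - by move=> y _; rewrite lee_fin divr_ge0 ?ltW.
  - exact: mVb1.
  - move=> y; rewrite in_itv/= => /andP[xy _].
    by rewrite lee_fin ler_pM2r ?invr_gt0// Vb_homo// ltW.
apply/andP; split; rewrite -lee_fin -hx EFinD.
  by rewrite addeC; apply: leeD.
by rewrite addeC; apply: leeD.
Qed.

Lemma integrated_tail_gt0 x : 0 <= x -> 0 < H x.
Proof.
move=> x0; have xx1 : x <= x + 1 by rewrite lerDl.
have /andP[+ _] := integrated_tail_split x0 xx1.
apply: lt_le_trans; rewrite addrAC subrr add0r mul1r ltr_wpDl ?divr_gt0//.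
rewrite -lee_fin -HE ?addr_ge0//.
by apply: integral_ge0 => y _; rewrite lee_fin divr_ge0 ?ltW.
Qed.

(** [H (l * x)] is [l] times the integral over [y > x] of [Vb (l * y) / m], whose
    integrand is uniformly close to [l `^ (- alpha) * Vb y / m] for large [x]. *)
Lemma integrated_tail_rv : regularly_varying H (1 - alpha).
Proof.
move=> l l0; apply/cvgrPdist_le => e e0.
have e'0 : 0 < e / l by rewrite divr_gt0.
have h : \forall x \near +oo, `|l `^ (- alpha) - Vb (l * x) / Vb x| <= e / l.
  by have /cvgrPdist_le := Vb_rv l0; apply.
have h' := near_pinfty_ge h.
near=> x.
have x0 : 0 < x by near: x; exact: nbhs_pinfty_gt.
have hx : forall t, x <= t -> `|l `^ (- alpha) - Vb (l * t) / Vb t| <= e / l.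
  by near: x.
have Hx := integrated_tail_gt0 (ltW x0).
have b1 y : x < y -> Vb (l * y) <= (l `^ (- alpha) + e / l) * Vb y.
  by move=> /ltW/hx; rewrite ler_distlC => /andP[_]; rewrite ler_pdivrMr.
have b2 y : x < y -> l `^ (- alpha) * Vb y <= Vb (l * y) + e / l * Vb y.
  move=> /ltW/hx; rewrite ler_distlC => /andP[+ _].
  by rewrite ler_pdivlMr// mulrBl lerBlDr.
have la0 : 0 <= l `^ (- alpha) by exact: powR_ge0.
have nn : forall y, `]x, +oo[%classic y -> (0 <= (Vb y / m)%:E)%E.
  by move=> y _; rewrite lee_fin divr_ge0 ?ltW.
have cst c : 0 <= c -> (\int[lebesgue_measure]_(y in `]x, +oo[) (c * (Vb y / m))%:E =
    (c * H x)%:E)%E.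
  move=> c0; rewrite EFinM -(HE (ltW x0)) -ge0_integralZl_EFin//.
  exact: mVb1.
have mc c : measurable_fun `]x, +oo[%classic (fun y => (c * (Vb y / m))%:E).
  apply/measurable_EFinP; apply: measurable_funM => //.
  by apply/measurable_EFinP; exact: mVb1.
have u1 : H (l * x) / l <= (l `^ (- alpha) + e / l) * H x.
  have c0 : 0 <= l `^ (- alpha) + e / l by rewrite addr_ge0// ltW.
  rewrite -lee_fin -integrated_tail_scale ?(ltW x0)// -cst//.
  apply: ge0_le_integral => //=.
  - by move=> y _; rewrite lee_fin.
  - exact: mVb.
  - exact: mc.
  - move=> y; rewrite in_itv/= andbT => xy.
    by rewrite lee_fin mulrA ler_pM2r ?invr_gt0// b1.
have u2 : l `^ (- alpha) * H x <= H (l * x) / l + e / l * H x.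
  rewrite -lee_fin EFinD -integrated_tail_scale ?(ltW x0)// -!cst ?(ltW e'0)//.
  rewrite -ge0_integralD//=.
  - apply: ge0_le_integral => //=.
    + by move=> y _; rewrite lee_fin mulr_ge0// divr_ge0 ?ltW.
    + exact: mc.
    + by apply: emeasurable_funD; [exact: mVb|exact: mc].
    + move=> y; rewrite in_itv/= andbT => xy; rewrite -EFinD lee_fin !mulrA -mulrDl.
      by rewrite ler_pM2r ?invr_gt0// b2.
  - by move=> y _; rewrite lee_fin.
  - exact: mVb.
  - by move=> y _; rewrite lee_fin mulr_ge0 ?(ltW e'0)// divr_ge0 ?ltW.
  - exact: mc.
have E : l `^ (1 - alpha) = l * l `^ (- alpha).
  by rewrite powRD ?powRr1 ?(ltW l0)// (gt_eqF l0) implybT.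
rewrite /= ler_distlC E; apply/andP; split.
  rewrite ler_pdivlMr// -(ler_pM2r (x := l^-1)) ?invr_gt0//.
  have -> : (l * l `^ (- alpha) - e) * H x / l =
            l `^ (- alpha) * H x - e / l * H x by field; rewrite gt_eqF.
  by rewrite lerBlDr.
rewrite ler_pdivrMr// -(ler_pM2r (x := l^-1)) ?invr_gt0//.
have -> // : (l * l `^ (- alpha) + e) * H x / l =
            (l `^ (- alpha) + e / l) * H x by field; rewrite gt_eqF.
Unshelve. all: by end_near. Qed.

(** [H x - H (2 * x)] lies between [x * Vb (2 * x) / m] and [x * Vb x / m]. As
    [alpha > 1], regular variation bounds [H (2 * x)] by a fixed fraction of
    [H x], so this difference is comparable to [H x]. *)
Lemma integrated_tail_karamata : exists c C, [/\ 0 < c, 0 < C &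
  \forall x \near +oo, c * (x * Vb x) <= H x <= C * (x * Vb x)].
Proof.
pose p : R := 2 `^ (- alpha) / 2; pose q : R := (1 + 2 `^ (1 - alpha)) / 2.
have p0 : 0 < 2 `^ (- alpha) :> R by exact: powR_gt0.
have q1 : 2 `^ (1 - alpha) < 1 :> R.
  by rewrite powR_expR// expR_lt1 nmulr_rlt0 ?ln_gt0 ?ltr1n// subr_lt0.
have q1' : 0 < 1 - q by rewrite /q; lra.
have hp : \forall x \near +oo, p < Vb (2 * x) / Vb x.
  by have := Vb_rv (ltr0n _ 2); move/cvgr_gt; apply; rewrite /p; lra.
have hq : \forall x \near +oo, H (2 * x) / H x < q.
  by have := integrated_tail_rv (ltr0n _ 2); move/cvgr_lt; apply; rewrite /q; lra.
exists (p / m), ((m * (1 - q))^-1); split.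
- by rewrite !divr_gt0.
- by rewrite invr_gt0 mulr_gt0.
near=> x.
have x0 : 0 < x by near: x; exact: nbhs_pinfty_gt.
have Hx := integrated_tail_gt0 (ltW x0).
have hpx : p < Vb (2 * x) / Vb x by near: x.
have hqx : H (2 * x) / H x < q by near: x.
rewrite ltr_pdivlMr// in hpx; rewrite ltr_pdivrMr// in hqx.
have x2 : x <= 2 * x by lra.
have /andP[lo up] := integrated_tail_split (ltW x0) x2.
have H2 : 0 <= H (2 * x) by rewrite ltW// integrated_tail_gt0//; lra.
have dx : 2 * x - x = x by ring.
rewrite dx in lo up.
apply/andP; split.
  have : x * (p * Vb x / m) <= x * (Vb (2 * x) / m).
    by rewrite ler_wpM2l ?(ltW x0)// ler_pM2r ?invr_gt0// ltW.
  have -> : p / m * (x * Vb x) = x * (p * Vb x / m) by ring.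
  lra.
rewrite mulrC ler_pdivlMr ?mulr_gt0//.
have : (1 - q) * H x <= x * (Vb x / m) by lra.
move/(ler_wpM2l (ltW m0)); have -> : m * (x * (Vb x / m)) = x * Vb x by field; rewrite gt_eqF.
by have -> : H x * (m * (1 - q)) = m * ((1 - q) * H x) by ring.
Unshelve. all: by end_near. Qed.

End integrated_tail.

(** * The exponential interarrival time *)

Section exponential_law.
Context (R : realType).
Local Notation GR := (measurableTypeR R).
Local Notation leb := (@lebesgue_measure R).
Implicit Types (s t x y z lam : R).

Lemma survivalE (nu : probability R R) x :
  nu `]x, +oo[%classic = (survival nu x)%:E.
Proof. by rewrite fineK// fin_num_measure. Qed.

Lemma measurable_survival (nu : probability R R) :
  measurable_fun setT (survival nu).
Proof.
by apply: nonincreasing_measurable => // y z yz; exact: survival_noninc.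
Qed.

Definition gt0_indic t : R := \1_(`](0 : R), +oo[%classic) t.
Definition ge0_indic t : R := \1_(`[(0 : R), +oo[%classic) t.

Lemma gt0_indicE t : gt0_indic t = (0 < t)%R%:R.
Proof. by rewrite /gt0_indic indicE; congr ((nat_of_bool _)%:R); apply/idP/idP; rewrite inE/= in_itv/= andbT. Qed.

Lemma ge0_indicE t : ge0_indic t = (0 <= t)%R%:R.
Proof. by rewrite /ge0_indic indicE; congr ((nat_of_bool _)%:R); apply/idP/idP; rewrite inE/= in_itv/= andbT. Qed.

Lemma gt0_indic_ge0 t : 0 <= gt0_indic t. Proof. by rewrite gt0_indicE. Qed.
Lemma ge0_indic_ge0 t : 0 <= ge0_indic t. Proof. by rewrite ge0_indicE. Qed.

Lemma measurable_gt0_indic : measurable_fun setT gt0_indic.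
Proof. exact: measurable_indic. Qed.
Lemma measurable_ge0_indic : measurable_fun setT ge0_indic.
Proof. exact: measurable_indic. Qed.

(** [P(A < t)] for an exponential variable [A] of rate [lam] and any real [t]. *)
Definition exp_cdf lam t : R := 1 - expR (- (lam * Num.max t 0)).

(** [P(A >= t)] for positive [t], cut off to 0 elsewhere so that
    [lam * exp_tail lam] is a density of [A]. *)
Definition exp_tail lam t : R := gt0_indic t * expR (- (lam * t)).

Lemma exp_cdf_ge0 lam t : 0 <= lam -> 0 <= exp_cdf lam t.
Proof.
move=> l0; rewrite subr_ge0 -[leRHS]expR0 ler_expR oppr_le0 mulr_ge0//.
by rewrite le_max lexx orbT.
Qed.

Lemma exp_tail_ge0 lam t : 0 <= exp_tail lam t.
Proof. by rewrite mulr_ge0 ?gt0_indic_ge0// expR_ge0. Qed.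

Lemma exp_cdf_tail lam t : gt0_indic t = exp_cdf lam t + exp_tail lam t.
Proof.
rewrite /exp_cdf /exp_tail gt0_indicE; have [t0|t0] := ltP 0 t.
  by rewrite mul1r subrK.
by rewrite mulr0 oppr0 expR0 mul0r addr0 subrr.
Qed.

Lemma measurable_exp_cdf lam : measurable_fun setT (exp_cdf lam).
Proof.
apply: measurable_funB => //; apply: measurableT_comp => //.
apply: measurable_funN; apply: measurable_funM => //.
exact: measurable_maxr.
Qed.

Lemma measurable_exp_tail lam : measurable_fun setT (exp_tail lam).
Proof.
apply: measurable_funM; first exact: measurable_gt0_indic.
by apply: measurableT_comp => //; apply: measurable_funN; apply: measurable_funM.
Qed.

Lemma exponential_prob_lt lam t :
  exponential_prob lam `]-oo, t[%classic = (exp_cdf lam t)%:E.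
Proof.
rewrite /exponential_prob /exp_cdf.
have E : (\int[leb]_(x in `]-oo, t[) (exponential_pdf lam x)%:E =
   \int[leb]_(x in `[0%R, t[) (exponential_pdf lam x)%:E)%E.
  have -> : `[0%R, t[%classic = `]-oo, t[%classic `&` `[0%R, +oo[%classic :> set R.
    by apply/seteqP; split => y /=; rewrite !in_itv/= ?andbT;
      [move=> /andP[-> ->]|case=> -> ->].
  rewrite [RHS]integral_mkcondr; apply: eq_integral => y _.
  rewrite patchE; case: ifPn => // y0; rewrite /exponential_pdf patchE.
  by rewrite (negbTE y0).
rewrite E; have [t0|t0] := ltP 0 t; last first.
  rewrite mulr0 oppr0 expR0 subrr.
  by rewrite set_itv_ge ?integral_set0// bnd_simp -leNgt.
rewrite integral_itv_bndo_bndc; last first.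
  by apply/measurable_EFinP; apply: measurable_funTS; exact: measurable_exponential_pdf.
by have := exponential_prob_itv0c lam t0; rewrite /exponential_prob => ->; rewrite mulNr.
Qed.

Lemma integral_itv_primitive (F f : R -> R) x y : x < y ->
  (forall z, is_derive z 1 F (f z)) -> continuous f ->
  (\int[leb]_(z in `[x, y]) (f z)%:E = (F y - F x)%:E)%E.
Proof.
move=> xy dF cf.
have cF : continuous F.
  by move=> z; apply/differentiable_continuous/derivable1_diffP; exact: ex_derive.
rewrite (@continuous_FTC2 _ f F)//.
- exact: continuous_subspaceT.
- split => [z _||].
  + exact: ex_derive.
  + exact/cvg_at_right_filter/cF.
  + exact/cvg_at_left_filter/cF.
- by move=> z _; rewrite derive1E; exact: derive_val.
Qed.

Lemma is_derive_affine (a b z : R) : is_derive z 1 (fun t : R => a * t + b) a.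
Proof.
have h1 : is_derive (z : R^o) (1 : R^o) (a *: (id : R^o -> R^o)) (a *: (1 : R^o)).
  exact: is_deriveZ.
have h2 : is_derive (z : R^o) (1 : R^o) (cst (b : R^o)) 0 by exact: is_derive_cst.
have := is_deriveD h1 h2.
by rewrite addr0 /GRing.scale/= mulr1.
Qed.

Lemma integral_exp_tail lam x y : 0 < lam ->
  (\int[leb]_z (gt0_indic (z - x) * (lam * exp_tail lam (y - z)))%:E =
   (exp_cdf lam (y - x))%:E)%E.
Proof.
move=> l0; pose f z : R := lam * expR (- (lam * (y - z))).
transitivity (\int[leb]_(z in `]x, y[) (f z)%:E)%E.
  rewrite [RHS]integral_mkcond; apply: eq_integral => z _.
  rewrite patchE /exp_tail !gt0_indicE !subr_gt0.
  case: ifPn; first by rewrite inE/= in_itv/= => /andP[-> ->]; rewrite !mul1r.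
  move=> /negP h; have [xz|] := ltP x z; last by rewrite mul0r.
  have [zy|] := ltP z y; last by rewrite mul0r mulr0 mulr0.
  by exfalso; apply: h; rewrite inE/= in_itv/= xz zy.
have mf : measurable_fun setT f.
  by apply: measurable_funM => //; apply: measurableT_comp => //;
     apply: measurable_funN; apply: measurable_funM => //; exact: measurable_funB.
rewrite /exp_cdf; have [xy|yx] := ltP x y; last first.
  rewrite set_itv_ge ?integral_set0 ?bnd_simp -?leNgt//.
  by rewrite max_r ?subr_le0// mulr0 oppr0 expR0 subrr.
rewrite max_l; last by rewrite subr_ge0 ltW.
rewrite integral_itv_bndo_bndc; last first.
  by apply/measurable_EFinP; exact: measurable_funTS.
rewrite integral_itv_obnd_cbnd; last first.
  by apply/measurable_EFinP; exact: measurable_funTS.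
pose g z := lam * z + - (lam * y).
have fE : f = fun z => lam * expR (g z).
  by apply/funext => z; rewrite /f /g; congr (_ * expR _); ring.
have dF z : is_derive z 1 (expR \o g) (f z).
  by rewrite fE mulrC; apply: is_derive1_comp; exact: is_derive_affine.
have cf : continuous f.
  move=> z; rewrite fE.
  apply: (@continuousM _ R^o (fun=> lam) (expR \o g)); first exact: cst_continuous.
  apply: continuous_comp; last exact: continuous_expR.
  apply/differentiable_continuous/derivable1_diffP.
  by have [] := is_derive_affine lam (- (lam * y)) z.
rewrite (integral_itv_primitive xy dF cf)/= /g subrr expR0.
by congr ((_ - expR _)%:E); ring.
Qed.

End exponential_law.

(** * From Lindley's equation to the renewal equation *)

(** Below, [w], [v] and [a] are the laws of the waiting time, of the service time
    and of the interarrival time, and [nu] is the stationary excess law of the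
    service time. *)

Section stationary_renewal.
Context (R : realType).
Local Notation GR := (measurableTypeR R).
Local Notation leb := (@lebesgue_measure R).
Implicit Types (s t x y z : R).
Variables (w v a : probability R R) (lam : R).
Hypotheses (lam0 : 0 < lam)
  (Hv : v `[0, +oo[%classic = 1%E)
  (Ha : forall B : set R, measurable B -> a B = exponential_prob lam B)
  (Hst : forall B : set R, measurable B ->
    w B = (w \x (v \x a))%E (@lindley R @^-1` B)).
Local Notation Y p := (p.1 + p.2).

Lemma stationary_nonneg : w `[0, +oo[%classic = 1%E.
Proof.
rewrite Hst// (_ : _ @^-1` _ = setT) ?probability_setT//.
apply/seteqP; split => // -[s [t r]] _ /=.
by rewrite in_itv/= andbT /lindley/= le_max lexx orbT.
Qed.

Lemma stationary_survival_neg x : x < 0 -> survival w x = 1.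
Proof.
move=> x0; apply/eqP; rewrite eq_le survival_le1/= -lee_fin -survivalE.
rewrite -stationary_nonneg le_measure ?inE//.
by apply: subset_itvr; rewrite bnd_simp.
Qed.

Lemma survival_v_neg x : x < 0 -> survival v x = 1.
Proof.
move=> x0; apply/eqP; rewrite eq_le survival_le1/= -lee_fin -survivalE.
rewrite -Hv le_measure ?inE//.
by apply: subset_itvr; rewrite bnd_simp.
Qed.

Lemma measurable_Y z : measurable_fun setT (fun p : R * R => Y p - z).
Proof.
by apply: measurable_funB => //; apply: measurable_funD.
Qed.

Lemma measurable_comp_Y (f : R -> R) z : measurable_fun setT f ->
  measurable_fun setT (fun p : R * R => (f (Y p - z))%:E).
Proof.
move=> mf; apply/measurable_EFinP.
exact: (measurableT_comp mf (measurable_Y z)).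
Qed.

(** Lindley's equation at the level [x >= 0]: the next customer waits more than
    [x] when [A < W + V - x]. *)
Lemma survival_exp_cdf x : 0 <= x ->
  (survival w x)%:E = (\int[w \x v]_p (exp_cdf lam (Y p - x))%:E)%E.
Proof.
move=> x0; rewrite -survivalE Hst// {1}/product_measure1.
rewrite fubini_tonelli1; last 2 first.
- exact: (measurable_comp_Y _ (measurable_exp_cdf lam)).
- by move=> p; rewrite lee_fin exp_cdf_ge0// ltW.
apply: eq_integral => s _; rewrite /fubini_F /= /product_measure1.
apply: eq_integral => t _ /=.
rewrite -exponential_prob_lt -Ha//; congr (a _).
apply/seteqP; split => r; rewrite /xsection/=.
  move=> /set_mem/= /set_mem/=; rewrite !in_itv/= andbT /lindley/=.
  by rewrite lt_max (ltNge x 0) x0 orbF => h; lra.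
rewrite in_itv/= => h; apply/mem_set => /=; apply/mem_set => /=.
by rewrite in_itv/= andbT /lindley/= lt_max; apply/orP; left; lra.
Qed.

Lemma sum_survival z :
  (\int[w \x v]_p (gt0_indic (Y p - z))%:E =
   \int[w]_s (survival v (z - s))%:E)%E.
Proof.
rewrite fubini_tonelli1; last 2 first.
- exact: (measurable_comp_Y _ (@measurable_gt0_indic R)).
- by move=> p; rewrite lee_fin gt0_indic_ge0.
apply: eq_integral => s _; rewrite /fubini_F /= -survivalE.
rewrite -[X in _ = v X]setIT -integral_indic//; apply: eq_integral => t _.
rewrite gt0_indicE indicE; congr ((nat_of_bool _)%:R%:E).
by apply/idP/idP; rewrite inE/= in_itv/= andbT; lra.
Qed.

Let measurable_surv_shift (nu : probability R R) z :
  measurable_fun setT (fun s : R => survival nu (z - s)).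
Proof. by apply: (measurableT_comp (measurable_survival nu)); exact: measurable_funB. Qed.

Let measurable_ge0_shift z : measurable_fun setT (fun s : R => ge0_indic (z - s)).
Proof. by apply: (measurableT_comp (@measurable_ge0_indic R)); exact: measurable_funB. Qed.

(** Both sides are [P(W + V > z) - P(W > z)]: on the left because, by Lindley's
    equation, [W + V > z] splits according to whether the interarrival time is
    less than [W + V - z]; on the right because this difference is
    [P(W <= z < W + V)]. *)
Lemma residual_identity z : 0 <= z ->
  (\int[w \x v]_p (exp_tail lam (Y p - z))%:E =
   \int[w]_s (ge0_indic (z - s) * survival v (z - s))%:E)%E.
Proof.
move=> z0; have := sum_survival z.
under eq_integral do rewrite (exp_cdf_tail lam) EFinD.
rewrite ge0_integralD//; last 4 first.
- by move=> p _; rewrite lee_fin exp_cdf_ge0// ltW.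
- exact: (measurable_comp_Y _ (measurable_exp_cdf lam)).
- by move=> p _; rewrite lee_fin exp_tail_ge0.
- exact: (measurable_comp_Y _ (measurable_exp_tail lam)).
rewrite -survival_exp_cdf//.
have -> : (\int[w]_s (survival v (z - s))%:E = (survival w z)%:E +
    \int[w]_s (ge0_indic (z - s) * survival v (z - s))%:E)%E.
  rewrite -survivalE -[X in (w X + _)%E]setIT -integral_indic// -ge0_integralD//.
  - apply: eq_integral => s _; rewrite -EFinD; congr EFin.
    rewrite ge0_indicE indicE; have [sz|zs] := leP s z.
      rewrite memNset/=; last by rewrite in_itv/= andbT ltNge sz.
      by rewrite subr_ge0 sz mul1r add0r.
    rewrite mem_set/=; last by rewrite in_itv/= andbT.
    by rewrite survival_v_neg ?subr_lt0// subr_ge0 leNgt zs mul0r addr0.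
  - by apply/measurable_EFinP; exact: measurable_indic.
  - by move=> s _; rewrite lee_fin mulr_ge0 ?ge0_indic_ge0// survival_ge0.
  - by apply/measurable_EFinP; apply: measurable_funM.
move/(congr1 (fun e => e - (survival w z)%:E)%E).
by rewrite ![((survival w z)%:E + _)%E]addeC !addeK.
Qed.

Variables (nu : probability R R) (m rho : R).
Hypotheses (m0 : 0 < m) (rho01 : 0 < rho < 1) (lamE : lam = rho / m).
Hypothesis Hnu : nu `]0, +oo[%classic = 1%E.
Hypothesis nuE : forall x, 0 <= x ->
  (\int[lebesgue_measure]_(y in `]x, +oo[) (survival v y / m)%:E =
   (survival nu x)%:E)%E.

Lemma survival_nu_neg x : x < 0 -> survival nu x = 1.
Proof.
move=> x0; apply/eqP; rewrite eq_le survival_le1/= -lee_fin -survivalE.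
rewrite -Hnu le_measure ?inE//.
by apply: subset_itvr; rewrite bnd_simp ltW.
Qed.

(** Integrating [lam * P(s <= z < s + V)] over [z > x] integrates the tail of
    [V] from [Num.max (x - s) 0] on. *)
Lemma integral_residual x s :
  (\int[leb]_z (gt0_indic (z - x) * (lam * (ge0_indic (z - s) * survival v (z - s))))%:E
   = (rho * survival nu (x - s))%:E)%E.
Proof.
have l0 := ltW lam0.
pose f t := gt0_indic (t - (x - s)) * (lam * (ge0_indic t * survival v t)).
have mf : measurable_fun setT f.
  apply: measurable_funM.
    by apply: (measurableT_comp (@measurable_gt0_indic R)); exact: measurable_funB.
  apply: measurable_funM => //; apply: measurable_funM.
    exact: (@measurable_ge0_indic R).
  exact: measurable_survival.
have f0 t : 0 <= f t.
  by rewrite !mulr_ge0 ?gt0_indic_ge0 ?ge0_indic_ge0 ?survival_ge0.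
transitivity (\int[leb]_t (f t)%:E)%E.
  rewrite (@integral_affine R 1 s [set: R] (fun z => (gt0_indic (z - x) *
    (lam * (ge0_indic (z - s) * survival v (z - s))))%:E))//.
  - rewrite mul1e preimage_setT; apply: eq_integral => t _.
    by rewrite /f mul1r addrK; congr ((gt0_indic _ * _)%:E); ring.
  - apply/measurable_EFinP.
    have := measurableT_comp mf (measurable_funB (@measurable_id _ _ setT) (measurable_cst s)).
    by apply: eq_measurable_fun => z _ /=; rewrite /f; congr (gt0_indic _ * _); ring.
  - by move=> z _; rewrite lee_fin !mulr_ge0 ?gt0_indic_ge0 ?ge0_indic_ge0 ?survival_ge0.
have key y : 0 <= y ->
    (\int[leb]_(t in `]y, +oo[) (lam * survival v t)%:E = (rho * survival nu y)%:E)%E.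
  move=> y0; rewrite EFinM -nuE//.
  have rho0 : 0 <= rho by case/andP: rho01 => /ltW.
  rewrite -ge0_integralZl_EFin//.
  - by apply: eq_integral => t _; rewrite -EFinM lamE; congr EFin; ring.
  - by move=> t _; rewrite lee_fin divr_ge0 ?survival_ge0// ltW.
  - apply/measurable_EFinP; apply: measurable_funM => //.
    by apply: measurable_funTS; exact: measurable_survival.
have [xs|xs] := leP 0 (x - s).
  rewrite -key// [RHS]integral_mkcond; apply: eq_integral => t _.
  rewrite patchE /f gt0_indicE ge0_indicE subr_gt0; case: ifPn.
    rewrite inE/= in_itv/= andbT => xst; rewrite xst mul1r.
    by rewrite (ltW (le_lt_trans xs xst)) mul1r.
  by rewrite notin_setE/= in_itv/= andbT => /negP/negbTE ->; rewrite mul0r.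
transitivity (\int[leb]_(t in `[0%R, +oo[) (lam * survival v t)%:E)%E.
  rewrite [RHS]integral_mkcond; apply: eq_integral => t _.
  rewrite patchE /f gt0_indicE ge0_indicE subr_gt0; case: ifPn.
    rewrite inE/= in_itv/= andbT => t0; rewrite t0 (lt_le_trans xs t0).
    by rewrite !mul1r.
  by rewrite notin_setE/= in_itv/= andbT => /negP/negbTE ->; rewrite mul0r !mulr0.
rewrite -integral_itv_obnd_cbnd; last first.
  apply/measurable_EFinP; apply: measurable_funM => //.
  by apply: measurable_funTS; exact: measurable_survival.
have h0 : survival nu 0 = 1 by rewrite /survival [X in fine X](_ : _ = 1%E) ?Hnu.
by rewrite key// h0 survival_nu_neg.
Qed.

Lemma survival_convolution x :
  (\int[w]_s (survival nu (x - s))%:E = \int[nu]_y (survival w (x - y))%:E)%E.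
Proof.
pose f (p : R * R) : \bar R := (gt0_indic (Y p - x))%:E.
have mf : measurable_fun setT f by exact: (measurable_comp_Y _ (@measurable_gt0_indic R)).
have f0 p : (0 <= f p)%E by rewrite lee_fin gt0_indic_ge0.
have h (mu : probability R R) s : (\int[mu]_t (gt0_indic (s + t - x))%:E =
    (survival mu (x - s))%:E)%E.
  rewrite -survivalE -[X in _ = mu X]setIT -integral_indic//; apply: eq_integral => t _.
  rewrite gt0_indicE indicE; congr ((nat_of_bool _)%:R%:E).
  by apply/idP/idP; rewrite inE/= in_itv/= andbT; lra.
transitivity (\int[w]_s \int[nu]_t f (s, t))%E.
  by apply: eq_integral => s _; rewrite -h.
rewrite (fubini_tonelli f)//; apply: eq_integral => t _; rewrite -h.
by apply: eq_integral => s _; rewrite /f/= (addrC s).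
Qed.

(** Integrated over [z > x] with the factor [lam], the left-hand side of
    [residual_identity] gives [P(A < W + V - x)], which is [P(W > x)] again, and
    its right-hand side gives [rho * P(W + X > x)], with [X] of law [nu]
    independent of [W]. *)
Theorem lindley_renewal : renewal_solution nu rho (survival w).
Proof.
split.
- exact: stationary_survival_neg.
- by move=> x; rewrite survival_ge0 survival_le1.
- exact: survival_noninc.
move=> x x0; have l0 := ltW lam0.
have rho0 : 0 <= rho by case/andP: rho01 => /ltW.
suff H : ((survival w x)%:E = \int[w]_s (rho * survival nu (x - s))%:E)%E.
  have sm : {homo (fun y => survival w (x - y)) : y z / y <= z}.
    by move=> y z yz; apply: survival_noninc; rewrite lerB.
  have bm : bounded_meas (fun y => survival w (x - y)).
    split; first exact: nondecreasing_measurable.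
    by exists 1 => y _; rewrite ger0_norm ?survival_ge0 ?survival_le1.
  have E : (\int[nu]_y (survival w (x - y))%:E =
            \int[nu]_(y in `]0%R, +oo[) (survival w (x - y))%:E)%E.
    have nu0 : nu `]-oo, 0]%classic = 0%E.
      rewrite -setCitvr probability_setC// Hnu subee//.
    rewrite (@ge0_negligible_integral _ _ _ nu setT `]-oo, 0]%classic)//.
    - by rewrite setTD setCitvl.
    - by apply/measurable_EFinP; exact: (nondecreasing_measurable _ sm).
    - by move=> y _; rewrite lee_fin survival_ge0.
  apply: EFin_inj; rewrite H EFinM /expect /Rintegral fineK; last first.
    by apply: integrable_fin_num => //; exact: bounded_meas_integrable.
  rewrite -E -survival_convolution.
  rewrite -ge0_integralZl_EFin//.
  - by move=> s _; rewrite lee_fin survival_ge0.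
  - exact/measurable_EFinP.
rewrite survival_exp_cdf//.
under eq_integral do rewrite -(integral_exp_tail _ _ lam0).
pose G (q : (R * R) * GR) : \bar R :=
  (gt0_indic (q.2 - x) * (lam * exp_tail lam (Y q.1 - q.2)))%:E.
have mG : measurable_fun setT G.
  apply/measurable_EFinP; apply: measurable_funM.
    apply: (measurableT_comp (@measurable_gt0_indic R)).
    by apply: measurable_funB => //; exact: measurable_snd.
  apply: measurable_funM => //.
  apply: (measurableT_comp (measurable_exp_tail lam)).
  apply: measurable_funB; last exact: measurable_snd.
  apply: measurable_funD.
    by apply: (measurableT_comp measurable_fst); exact: measurable_fst.
  by apply: (measurableT_comp measurable_snd); exact: measurable_fst.
have G0 q : (0 <= G q)%E.
  by rewrite lee_fin !mulr_ge0 ?gt0_indic_ge0 ?exp_tail_ge0.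
pose wv : probability (R * R)%type R := (w \x v)%E.
have FT := @fubini_tonelli _ _ _ _ R wv leb G mG G0.
rewrite [LHS]FT.
pose K (q : R * GR) : \bar R :=
  (gt0_indic (q.2 - x) * (lam * (ge0_indic (q.2 - q.1) * survival v (q.2 - q.1))))%:E.
have mK : measurable_fun setT K.
  apply/measurable_EFinP; apply: measurable_funM.
    apply: (measurableT_comp (@measurable_gt0_indic R)).
    by apply: measurable_funB => //; exact: measurable_snd.
  have md : measurable_fun setT (fun q : R * GR => q.2 - q.1).
    by apply: measurable_funB; [exact: measurable_snd|exact: measurable_fst].
  apply: measurable_funM => //; apply: measurable_funM.
    exact: (measurableT_comp (@measurable_ge0_indic R)).
  exact: (measurableT_comp (measurable_survival v)).
have K0 q : (0 <= K q)%E.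
  by rewrite lee_fin !mulr_ge0 ?gt0_indic_ge0 ?ge0_indic_ge0 ?survival_ge0.
transitivity (\int[leb]_z \int[w]_s K (s, z))%E; last first.
  rewrite -(fubini_tonelli K mK K0); apply: eq_integral => s _.
  exact: integral_residual.
apply: eq_integral => z _.
have [zx|xz] := leP z x.
  rewrite !integral0_eq// => q _; rewrite /G /K/= gt0_indicE subr_gt0 ltNge zx/=.
    by rewrite mul0r.
  by rewrite mul0r.
have c0 : 0 <= gt0_indic (z - x) * lam by rewrite mulr_ge0// gt0_indic_ge0.
rewrite /G /K/=.
under eq_integral do rewrite mulrA EFinM.
under [RHS]eq_integral do rewrite mulrA EFinM.
rewrite ge0_integralZl_EFin//; last 2 first.
- by move=> p _; rewrite lee_fin exp_tail_ge0.
- exact: (measurable_comp_Y _ (measurable_exp_tail lam)).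
rewrite ge0_integralZl_EFin//; last 2 first.
- by move=> s _; rewrite lee_fin mulr_ge0 ?ge0_indic_ge0 ?survival_ge0.
- by apply/measurable_EFinP; apply: measurable_funM.
by rewrite residual_identity// ltW// (le_lt_trans x0).
Qed.

End stationary_renewal.

(** * The mean of the stationary excess *)

Section layer_cake.
Context (R : realType).
Local Notation GR := (measurableTypeR R).
Local Notation leb := (@lebesgue_measure R).
Implicit Types (s t x y z : R) (nu : probability R R).

Lemma layer_cake nu (g : R -> R) : measurable_fun setT g ->
  (forall z, 0 < z -> 0 <= g z) ->
  (\int[nu]_t \int[leb]_z (gt0_indic z * g z * gt0_indic (t - z))%:E =
   \int[leb]_z (gt0_indic z * g z * survival nu z)%:E)%E.
Proof.
move=> mg g0; have gg0 z : 0 <= gt0_indic z * g z.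
  by rewrite gt0_indicE; have [z0|_] := ltP 0 z; rewrite ?mul1r ?mul0r ?g0.
have mgg : measurable_fun setT (fun z => gt0_indic z * g z).
  by apply: measurable_funM => //; exact: measurable_gt0_indic.
pose G (q : R * GR) : \bar R := (gt0_indic q.2 * g q.2 * gt0_indic (q.1 - q.2))%:E.
have mG : measurable_fun setT G.
  apply/measurable_EFinP; apply: measurable_funM.
    by apply: (measurableT_comp mgg); exact: measurable_snd.
  apply: (measurableT_comp (@measurable_gt0_indic R)).
  by apply: measurable_funB => //; exact: measurable_snd.
have G0 q : (0 <= G q)%E by rewrite lee_fin mulr_ge0 ?gt0_indic_ge0.
rewrite (@fubini_tonelli _ _ _ _ R nu leb G mG G0).
apply: eq_integral => z _; rewrite /G/=.
under eq_integral do rewrite EFinM.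
rewrite ge0_integralZl_EFin//; last 2 first.
- by move=> t _; rewrite lee_fin gt0_indic_ge0.
- apply/measurable_EFinP; apply: (measurableT_comp (@measurable_gt0_indic R)).
  by apply: measurable_funB.
rewrite [RHS]EFinM; congr (_ * _)%E.
rewrite -survivalE -[X in _ = nu X]setIT -integral_indic//; apply: eq_integral => t _.
rewrite gt0_indicE indicE; congr ((nat_of_bool _)%:R%:E).
by rewrite subr_gt0; apply/idP/idP; rewrite inE/= in_itv/= andbT.
Qed.

Lemma integral_gt0_indic t :
  (\int[leb]_z (gt0_indic z * gt0_indic (t - z))%:E = (Num.max t 0)%:E)%E.
Proof.
transitivity (\int[leb]_(z in `]0%R, t[) 1)%E.
  rewrite [RHS]integral_mkcond; apply: eq_integral => z _.
  rewrite patchE !gt0_indicE subr_gt0; case: ifPn.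
    by rewrite inE/= in_itv/= => /andP[-> ->]; rewrite mulr1.
  rewrite notin_setE/= in_itv/= => /negP/nandP[] /negbTE ->; by rewrite ?mulr0 ?mul0r.
rewrite integral_cst//= mul1e lebesgue_measure_itv/= lte_fin.
by have [t0|t0] := ltP 0 t; [rewrite oppr0 adde0|].
Qed.

Lemma integral_gt0_indic_id t :
  (\int[leb]_z (gt0_indic z * z * gt0_indic (t - z))%:E = (Num.max t 0 ^+ 2 / 2)%:E)%E.
Proof.
transitivity (\int[leb]_(z in `]0%R, t[) z%:E)%E.
  rewrite [RHS]integral_mkcond; apply: eq_integral => z _.
  rewrite patchE !gt0_indicE subr_gt0; case: ifPn.
    by rewrite inE/= in_itv/= => /andP[-> ->]; rewrite mulr1 mul1r.
  rewrite notin_setE/= in_itv/= => /negP/nandP[] /negbTE ->; by rewrite ?mulr0 ?mul0r.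
have [t0|t0] := ltP 0 t; last first.
  by rewrite set_itv_ge ?integral_set0 ?bnd_simp -?leNgt// expr0n/= mul0r.
rewrite integral_itv_bndo_bndc; last exact/measurable_EFinP.
rewrite integral_itv_obnd_cbnd; last exact/measurable_EFinP.
have dF z : is_derive z 1 (fun z : R => z ^+ 2 / 2) z.
  have h1 : is_derive (z : R^o) (1 : R^o) (id : R^o -> R^o) (1 : R^o) by exact: is_derive_id.
  have h2 := @is_deriveM R _ _ _ _ _ _ _ h1 h1.
  have h3 := @is_deriveZ R _ _ _ (2^-1) _ _ _ h2.
  have -> : (fun z : R => z ^+ 2 / 2) = (2^-1 *: ((id : R^o -> R^o) * id)).
    by apply/funext => y; rewrite /GRing.scale/= mulrC expr2.
  suff E : 2^-1 *: ((id z) *: (1 : R^o) + (id z) *: (1 : R^o)) = z :> R^o by rewrite E in h3.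
  by rewrite /GRing.scale/= mulr1; field.
rewrite (integral_itv_primitive t0 dF); last by move=> z; exact: cvg_id.
by rewrite expr0n/= mul0r subr0.
Qed.

(** Up to the factor [2 * m], both sides are the double integral of
    [survival v y / m] over [0 < z < y]: integrating over [z] first gives
    [y * survival v y / m], and over [y] first gives [survival nu z]. *)
Lemma second_moment_stationary_excess (v nu : probability R R) (m : R) : 0 < m ->
  (forall x, 0 <= x ->
    (\int[leb]_(y in `]x, +oo[) (survival v y / m)%:E = (survival nu x)%:E)%E) ->
  v `[0, +oo[%classic = 1%E ->
  (\int[v]_t (t ^+ 2)%:E = (2 * m)%:E * \int[nu]_(y in `]0%R, +oo[) y%:E)%E.
Proof.
move=> m0 nuE v1.
have step1 : (\int[nu]_(y in `]0%R, +oo[) y%:E =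
    \int[leb]_z (gt0_indic z * survival nu z)%:E)%E.
  transitivity (\int[leb]_z (gt0_indic z * 1 * survival nu z)%:E)%E; last first.
    by apply: eq_integral => z _; rewrite mulr1.
  rewrite -(@layer_cake nu (fun=> 1))//.
  rewrite integral_mkcond; apply: eq_integral => y _.
  under eq_integral do rewrite mulr1.
  rewrite integral_gt0_indic patchE; case: ifPn.
    by rewrite inE/= in_itv/= andbT => y0; rewrite max_l// ltW.
  by rewrite notin_setE/= in_itv/= andbT => /negP; rewrite -leNgt => y0; rewrite max_r.
have ms := measurable_survival v.
have step2 : (\int[leb]_z (gt0_indic z * survival nu z)%:E =
    \int[leb]_y (m^-1 * (gt0_indic y * y * survival v y))%:E)%E.
  pose G (q : GR * GR) : \bar R :=
    (gt0_indic q.1 * (gt0_indic (q.2 - q.1) * (survival v q.2 / m)))%:E.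
  have mG : measurable_fun setT G.
    apply/measurable_EFinP; apply: measurable_funM.
      by apply: (measurableT_comp (@measurable_gt0_indic R)); exact: measurable_fst.
    apply: measurable_funM.
      apply: (measurableT_comp (@measurable_gt0_indic R)).
      by apply: measurable_funB; [exact: measurable_snd|exact: measurable_fst].
    by apply: measurable_funM => //; apply: (measurableT_comp ms); exact: measurable_snd.
  have G0 q : (0 <= G q)%E.
    by rewrite lee_fin !mulr_ge0 ?gt0_indic_ge0 ?survival_ge0 ?invr_ge0// ltW.
  transitivity (\int[leb]_z \int[leb]_y G (z, y))%E.
    apply: eq_integral => z _; rewrite /G/= gt0_indicE.
    have [z0|z0] := ltP 0 z; last first.
      by rewrite mul0r integral0_eq// => y _; rewrite mul0r.
    rewrite mul1r -nuE ?(ltW z0)// integral_mkcond; apply: eq_integral => y _.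
    rewrite patchE gt0_indicE subr_gt0 mul1r; case: ifPn.
      by rewrite inE/= in_itv/= andbT => ->; rewrite mul1r.
    by rewrite notin_setE/= in_itv/= andbT => /negP/negbTE ->; rewrite mul0r.
  rewrite (@fubini_tonelli _ _ _ _ R leb leb G mG G0); apply: eq_integral => y _.
  transitivity (\int[leb]_z ((survival v y / m) * (gt0_indic z * gt0_indic (y - z)))%:E)%E.
    by apply: eq_integral => z _; rewrite /G/=; congr EFin; ring.
  under eq_integral do rewrite EFinM.
  rewrite ge0_integralZl_EFin//; last 3 first.
  - by move=> z _; rewrite lee_fin mulr_ge0 ?gt0_indic_ge0.
  - apply/measurable_EFinP; apply: measurable_funM; first exact: measurable_gt0_indic.
    by apply: (measurableT_comp (@measurable_gt0_indic R)); exact: measurable_funB.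
  - by rewrite divr_ge0 ?survival_ge0// ltW.
  rewrite integral_gt0_indic -EFinM gt0_indicE; congr EFin.
  by have [y0|y0] := ltP 0 y; rewrite ?mul1r ?mul0r ?mulr0//; ring.
have step3 : (\int[leb]_y (m^-1 * (gt0_indic y * y * survival v y))%:E =
    (m^-1)%:E * \int[leb]_y (gt0_indic y * y * survival v y)%:E)%E.
  under eq_integral do rewrite EFinM.
  rewrite ge0_integralZl_EFin//.
  - move=> y _; rewrite lee_fin gt0_indicE.
    by have [y0|y0] := ltP 0 y; rewrite ?mul0r ?mul1r ?mulr_ge0 ?survival_ge0// ltW.
  - apply/measurable_EFinP; apply: measurable_funM => //.
    by apply: measurable_funM => //; exact: measurable_gt0_indic.
  - by rewrite invr_ge0 ltW.
have id_ge0 z : 0 < z -> 0 <= id z by move/ltW.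
rewrite step1 step2 step3 -(layer_cake v (@measurable_id _ _ setT) id_ge0).
under [in RHS]eq_integral do rewrite integral_gt0_indic_id.
rewrite muleA -EFinM (_ : 2 * m * m^-1 = 2); last by field; rewrite gt_eqF.
rewrite -ge0_integralZl_EFin//; last 2 first.
- by move=> t _; rewrite lee_fin divr_ge0 ?sqr_ge0.
- apply/measurable_EFinP; apply: measurable_funM => //.
  by apply: measurable_funX; exact: measurable_maxr.
have v0 : v (~` `[0, +oo[%classic) = 0%E.
  by rewrite probability_setC// v1 subee.
have restr (f : R -> R) : measurable_fun setT f -> (forall t, 0 <= f t) ->
    (\int[v]_t (f t)%:E = \int[v]_(t in `[0%R, +oo[) (f t)%:E)%E.
  move=> mf f0; rewrite (@ge0_negligible_integral _ _ _ v setT (~` `[0, +oo[%classic))//.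
  - by rewrite setTD setCK.
  - exact: measurableC.
  - exact/measurable_EFinP.
  - by move=> t _; rewrite lee_fin.
rewrite restr; [|exact: exprn_measurable|by move=> t; rewrite sqr_ge0].
under [in RHS]eq_integral do rewrite -EFinM.
rewrite restr; last 2 first.
- apply: measurable_funM => //; apply: measurable_funM => //.
  by apply: measurable_funX; exact: measurable_maxr.
- by move=> t; rewrite mulr_ge0// divr_ge0 ?sqr_ge0.
apply: eq_integral => t; rewrite inE/= in_itv/= andbT => t0.
by rewrite max_l//; congr EFin; field.
Qed.

End layer_cake.

(** * Logarithms against powers near infinity *)

Section near_infinity.
Context (R : realType).
Implicit Types (x y k e A B K : R).

Lemma near_ln_ge A : \forall x \near +oo, A <= ln x.
Proof.
near=> x; have x0 : 0 < x by near: x; exact: nbhs_pinfty_gt.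
rewrite -(expRK A) ler_ln ?posrE ?expR_gt0//.
Unshelve. all: by end_near. Qed.

Lemma ln_le_powR B x : 0 < B -> 0 < x -> ln x <= B^-1 * x `^ B.
Proof.
move=> B0 x0; rewrite mulrC ler_pdivlMr// mulrC -ln_powR.
by rewrite ltW// ln_sublinear// powR_gt0.
Qed.

Lemma near_powR_le K B e : 0 <= K -> 0 < B -> 0 < e ->
  \forall x \near +oo, K * x `^ (- B) <= e.
Proof.
move=> K0 B0 e0; have K1 : 0 < K + 1 by lra.
near=> x; have x0 : 0 < x by near: x; exact: nbhs_pinfty_gt.
have h : (ln (K + 1) - ln e) / B <= ln x by near: x; exact: near_ln_ge.
apply: (@le_trans _ _ ((K + 1) * x `^ (- B))).
  by rewrite ler_wpM2r ?powR_ge0//; lra.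
rewrite powR_expR// -[K + 1]lnK ?posrE// -[leRHS]lnK ?posrE// -expRD ler_expR.
by move: h; rewrite ler_pdivrMr// mulrC; lra.
Unshelve. all: by end_near. Qed.

Lemma near_ln_powR_le K B e : 0 <= K -> 0 < B -> 0 < e ->
  \forall x \near +oo, K * ln x * x `^ (- B) <= e.
Proof.
move=> K0 B0 e0; have B2 : 0 < B / 2 by rewrite divr_gt0.
near=> x; have x0 : 0 < x by near: x; exact: nbhs_pinfty_gt.
apply: (@le_trans _ _ (K * (B / 2)^-1 * x `^ (- (B / 2)))); last first.
  near: x; apply: near_powR_le => //.
  by rewrite mulr_ge0// invr_ge0 ltW.
have -> : x `^ (- (B / 2)) = x `^ (B / 2) * x `^ (- B).
  rewrite -powRD; last by rewrite (gt_eqF x0) implybT.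
  by congr (_ `^ _); field.
rewrite mulrA ler_wpM2r ?powR_ge0// -mulrA ler_wpM2l//.
exact: ln_le_powR.
Unshelve. all: by end_near. Qed.

Definition log_rate x : R := ln x / x.

Lemma log_rate_mul x : 0 < x -> log_rate x * x = ln x.
Proof. by move=> x0; rewrite divfK// gt_eqF. Qed.

Lemma near_log_rate_le K e : 0 <= K -> 0 < e ->
  \forall x \near +oo, K * log_rate x <= e.
Proof.
move=> K0 e0; near=> x; have x0 : 0 < x by near: x; exact: nbhs_pinfty_gt.
rewrite /log_rate mulrA -powR_inv1 ?(ltW x0)//.
by near: x; exact: near_ln_powR_le.
Unshelve. all: by end_near. Qed.

Lemma near_log_rate_powR p e : 0 < p <= 1 -> 0 < e ->
  \forall x \near +oo, log_rate x `^ (1 + p) * x <= e.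
Proof.
move=> /andP[p0 p1] e0; have p4 : 0 < p / 4 by lra.
near=> x; have x0 : 0 < x by near: x; exact: nbhs_pinfty_gt.
have l1 : 1 <= ln x by near: x; exact: near_ln_ge.
apply: (@le_trans _ _ ((p / 4)^-1 ^+ 2 * x `^ (- (p / 2)))); last first.
  by near: x; apply: near_powR_le; rewrite ?sqr_ge0//; lra.
have xn : x != 0 by rewrite gt_eqF.
have l0 : 0 <= ln x by lra.
rewrite /log_rate powRM ?invr_ge0 ?(ltW x0)//.
have -> : x^-1 `^ (1 + p) = x `^ (- (1 + p)).
  by rewrite -powR_inv1 ?(ltW x0)// -powRrM mulN1r.
rewrite -mulrA.
have -> : x `^ (- (1 + p)) * x = x `^ (- p).
  rewrite -[X in _ * X]powRr1 ?(ltW x0)// -powRD ?xn ?implybT//.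
  by congr (_ `^ _); ring.
have -> : x `^ (- (p / 2)) = (x `^ (p / 4)) ^+ 2 * x `^ (- p).
  rewrite -powR_mulrn ?powR_ge0// -powRrM -powRD ?xn ?implybT//.
  by congr (_ `^ _); field.
rewrite mulrA -exprMn ler_wpM2r ?powR_ge0//.
apply: (@le_trans _ _ (ln x ^+ 2)).
  by rewrite -powR_mulrn// ler_powR//; lra.
by rewrite ler_pXn2r ?nnegrE ?ln_le_powR ?mulr_ge0 ?powR_ge0// invr_ge0 ltW.
Unshelve. all: by end_near. Qed.

Lemma mul_expRN_le t0 t : 1 <= t0 -> t0 <= t ->
  t * expR (- t) <= t0 * expR (- t0) :> R.
Proof.
move=> t1 tt; have t00 : 0 < t0 by lra.
have h := expR_ge1Dx (t - t0).
have h2 : t / t0 <= 1 + (t - t0).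
  rewrite ler_pdivrMr//.
  have : 0 <= (t0 - 1) * (t - t0) by rewrite mulr_ge0; lra.
  lra.
have h3 : t <= t0 * expR (t - t0).
  by rewrite mulrC -ler_pdivrMr// (le_trans h2).
apply: (le_trans (ler_wpM2r (expR_ge0 _) h3)).
by rewrite -mulrA -expRD (_ : t - t0 - t = - t0)//; ring.
Qed.

End near_infinity.

(** * Estimates uniform in the traffic intensity *)

Section uniform_estimates.
Context (R : realType) (nu : probability R R) (alpha mu : R) (u : R -> R -> R).
Local Notation H := (survival nu).
Local Notation a := (alpha - 2).
Hypotheses (nu_pos : nu `]0, +oo[%classic = 1%E) (alpha2 : 2 < alpha) (mu0 : 0 < mu).
Hypothesis u_sol : forall rho, 0 < rho < 1 -> renewal_solution nu rho (u rho).
Hypothesis mgf_bound : forall s, 0 < s < a -> exists p C, [/\ 0 < p <= 1, 0 <= C &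
  forall gamma b, 0 <= gamma -> 0 < b -> mgf_trunc nu gamma b <=
    1 + gamma * mu + C * gamma `^ (1 + p) + C * expR (gamma * b) * b `^ (- (1 + s))].
Hypothesis mean_bound : exists s M, [/\ 0 < s, 0 <= M &
  forall K, 0 < K -> mu <= mean_trunc nu K + M * K `^ (- s)].
Hypothesis mean_le : forall K, mean_trunc nu K <= mu.
Hypothesis H_gt0 : forall x, 0 < H x.
Hypothesis H_rv : regularly_varying H (1 - alpha).
Hypothesis H_upper : forall r, 0 < r < alpha - 1 -> exists2 C, 0 <= C &
  forall y, 1 <= y -> H y <= C * y `^ (- r).
Hypothesis H_lower : forall r, alpha - 1 < r -> exists2 c, 0 < c &
  \forall y \near +oo, c * y `^ (- r) <= H y.

Implicit Types (x k e rho b s p C : R).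

Local Ltac lra_alone :=
  clear - nu_pos alpha2 mu0 u_sol mgf_bound mean_bound mean_le H_gt0 H_rv
          H_upper H_lower; intros; lra.

Local Notation T := (@log_rate R).

Definition decay_rate rho : R := (1 - rho) / mu.
Local Notation theta := decay_rate.

Lemma decay_rateM rho : theta rho * mu = 1 - rho.
Proof. by rewrite divfK// gt_eqF. Qed.

Lemma decay_rate_gt0 rho : rho < 1 -> 0 < theta rho.
Proof. by move=> r1; rewrite divr_gt0// subr_gt0. Qed.

Lemma scaled_powR x b s : 0 < x -> 0 < b ->
  (b * x) `^ (- (1 + s)) * x = b `^ (- (1 + s)) * x `^ (- s).
Proof.
move=> x0 b0; rewrite powRM ?(ltW x0) ?(ltW b0)// -mulrA; congr (_ * _).
rewrite -[X in _ * X]powRr1 ?(ltW x0)// -powRD ?(gt_eqF x0) ?implybT//.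
by congr (_ `^ _); ring.
Qed.

(** A truncation at [b * x] makes the exponential factor at most
    [x `^ (k * b)], while [(b * x) `^ (- (1 + s)) * x] is of order
    [x `^ (- s)]. *)
Lemma near_mgf_error s p C k b e : 0 < p <= 1 -> 0 <= C -> 0 < k -> 0 < b ->
    k * b < s -> 0 < e ->
  \forall x \near +oo, forall g, 0 <= g <= k * T x ->
    (C * g `^ (1 + p) + C * expR (g * (b * x)) * (b * x) `^ (- (1 + s))) * x <= e.
Proof.
move=> p01 C0 k0 b0 kbs e0; have C1 : 0 < C + 1 by lra.
have c1 : 0 < (C + 1) * k `^ (1 + p) by rewrite mulr_gt0// powR_gt0.
have c2 : 0 <= C * b `^ (- (1 + s)) by rewrite mulr_ge0// powR_ge0.
have p1 : 0 <= 1 + p by case/andP: p01; lra.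
near=> x => g /andP[g0 gk].
have x0 : 0 < x by near: x; exact: nbhs_pinfty_gt.
have l1 : 1 <= ln x by near: x; exact: near_ln_ge.
have t0 : 0 <= T x by rewrite divr_ge0 ?(ltW x0)//; lra.
have kT0 : 0 <= k * T x by rewrite mulr_ge0// ltW.
have h1 : T x `^ (1 + p) * x <= e / 2 / ((C + 1) * k `^ (1 + p)).
  by near: x; apply: near_log_rate_powR => //; rewrite !divr_gt0.
have h2 : C * b `^ (- (1 + s)) * x `^ (- (s - k * b)) <= e / 2.
  by near: x; apply: near_powR_le; rewrite ?subr_gt0 ?divr_gt0.
rewrite mulrDl [e]splitr lerD//.
  rewrite ler_pdivlMr// in h1; apply: le_trans h1.
  have -> : T x `^ (1 + p) * x * ((C + 1) * k `^ (1 + p)) =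
      (C + 1) * (k * T x) `^ (1 + p) * x by rewrite powRM ?(ltW k0)//; ring.
  rewrite ler_wpM2r ?(ltW x0)// ler_pM ?powR_ge0//; first by lra.
  by rewrite ge0_ler_powR ?nnegrE.
apply: le_trans h2.
have -> : C * expR (g * (b * x)) * (b * x) `^ (- (1 + s)) * x =
   C * b `^ (- (1 + s)) * (expR (g * (b * x)) * x `^ (- s)).
  by rewrite -[LHS]mulrA scaled_powR//; ring.
rewrite ler_wpM2l//.
have -> : - (s - k * b) = k * b + - s by ring.
rewrite powRD ?(gt_eqF x0) ?implybT// ler_wpM2r ?powR_ge0//.
rewrite powR_expR// ler_expR.
have -> : k * b * ln x = k * T x * (b * x).
  by rewrite -(log_rate_mul x0); ring.
by rewrite ler_wpM2r// mulr_ge0 ?ltW.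
Unshelve. all: by end_near. Qed.

Lemma mgf_trunc0 b : mgf_trunc nu 0 b = 1.
Proof.
rewrite /mgf_trunc -[RHS](expect_cst nu_pos); congr expect; apply/funext => y.
by rewrite mul0r expR0.
Qed.

Lemma rho_mul_le1 rho : rho * (1 + theta rho * mu) <= 1.
Proof.
rewrite decay_rateM.
have -> : rho * (1 + (1 - rho)) = 1 - (1 - rho) ^+ 2 by ring.
by rewrite gerBl sqr_ge0.
Qed.

(** To first order the Lundberg exponent is [theta]; lowering it by [e / x] pays
    for the error terms of [mgf_bound]. If [theta] itself is below [e / x], the
    exponent 0 will do. *)
Lemma near_lundberg_exponent k b e : 0 < k -> 0 < b -> k * b < a -> 0 < e ->
  \forall x \near +oo, forall rho, 0 < rho < 1 -> theta rho <= k * T x ->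
    exists gamma, [/\ 0 <= gamma, rho * mgf_trunc nu gamma (b * x) <= 1 &
      expR (- (gamma * x)) <= expR e * expR (- (theta rho * x))].
Proof.
move=> k0 b0 kba e0; have kb0 : 0 < k * b by rewrite mulr_gt0.
pose s := (k * b + a) / 2.
have sa : 0 < s < a by apply/andP; split; rewrite /s; lra.
have kbs : k * b < s by rewrite /s; lra.
have [p [C [p01 C0 HC]]] := mgf_bound sa.
near=> x => rho /andP[rho0 rho1] th.
have x0 : 0 < x by near: x; exact: nbhs_pinfty_gt.
have th0 := decay_rate_gt0 rho1.
have err : forall g, 0 <= g <= k * T x ->
    (C * g `^ (1 + p) + C * expR (g * (b * x)) * (b * x) `^ (- (1 + s))) * x <= e * mu.
  by near: x; apply: near_mgf_error => //; exact: mulr_gt0.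
have [ex|xe] := leP (e / x) (theta rho); last first.
  exists 0; rewrite mul0r mgf_trunc0 mulr1 oppr0 expR0 (ltW rho1); split => //.
  rewrite -expRD -[leLHS]expR0 ler_expR subr_ge0.
  by rewrite -ler_pdivlMr// ltW.
pose g := theta rho - e / x.
have g0 : 0 <= g by rewrite subr_ge0.
have ex0 : 0 < e / x by rewrite divr_gt0.
have gk : 0 <= g <= k * T x by rewrite g0/= /g; lra.
exists g; split => //.
  apply: le_trans (rho_mul_le1 rho); rewrite ler_wpM2l ?(ltW rho0)//.
  have bx0 : 0 < b * x by rewrite mulr_gt0.
  apply: (le_trans (HC _ _ g0 bx0)).
  have := err g gk; rewrite -ler_pdivlMr// => h.
  have hE : theta rho * mu = g * mu + e * mu / x by rewrite /g; ring.
  rewrite hE; lra.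
rewrite -expRD ler_expR /g mulrBl divfK ?gt_eqF//; lra.
Unshelve. all: by end_near. Qed.

Lemma near_mgf_le g b : 0 < g -> 0 < b -> g * b < a ->
  \forall x \near +oo, mgf_trunc nu (g * T x) (b * x) <= 1 + 2 * (g * T x) * mu.
Proof.
move=> g0 b0 gba; have gb0 : 0 < g * b by rewrite mulr_gt0.
pose s := (g * b + a) / 2.
have sa : 0 < s < a by apply/andP; split; rewrite /s; lra.
have gbs : g * b < s by rewrite /s; lra.
have [p [C [p01 C0 HC]]] := mgf_bound sa.
near=> x.
have x0 : 0 < x by near: x; exact: nbhs_pinfty_gt.
have l1 : 1 <= ln x by near: x; exact: near_ln_ge.
have t0 : 0 <= T x by rewrite divr_ge0 ?(ltW x0)//; lra.
have gT0 : 0 <= g * T x by rewrite mulr_ge0// ltW.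
have err : forall h, 0 <= h <= g * T x ->
    (C * h `^ (1 + p) + C * expR (h * (b * x)) * (b * x) `^ (- (1 + s))) * x <= g * mu.
  by near: x; apply: near_mgf_error => //; exact: mulr_gt0.
have bx0 : 0 < b * x by rewrite mulr_gt0.
apply: (le_trans (HC _ _ gT0 bx0)).
have := err (g * T x); rewrite gT0 lexx => /(_ isT).
rewrite -ler_pdivlMr// => h.
have h2 : g * mu / x <= g * T x * mu.
  have -> : g * T x * mu = g * mu / x * ln x by rewrite /log_rate; ring.
  by rewrite ler_peMr// divr_ge0 ?mulr_ge0// ltW.
lra.
Unshelve. all: by end_near. Qed.

Lemma near_rho_ge k e : 0 < k -> 0 < e ->
  \forall x \near +oo, forall rho, theta rho <= k * T x -> 1 - rho <= e.
Proof.
move=> k0 e0; near=> x => rho th; rewrite -decay_rateM.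
apply: (@le_trans _ _ (mu * k * T x)).
  by rewrite mulrC -mulrA ler_wpM2l// ltW.
near: x; apply: near_log_rate_le => //; by rewrite mulr_ge0 ?ltW.
Unshelve. all: by end_near. Qed.

(** As [k < a], the Lundberg exponent for jumps truncated at [x] itself is close
    enough to [theta]. *)
Lemma exponential_upper k e : 0 < k < a -> 0 < e ->
  \forall x \near +oo, forall rho, 0 < rho < 1 -> theta rho <= k * T x ->
    u rho x <= expR e * expR (- (theta rho * x)).
Proof.
move=> /andP[k0 ka] e0; near=> x => rho rho01 th.
have x0 : 0 < x by near: x; exact: nbhs_pinfty_gt.
have : forall rho, 0 < rho < 1 -> theta rho <= k * T x ->
    exists gamma, [/\ 0 <= gamma, rho * mgf_trunc nu gamma (1 * x) <= 1 &
      expR (- (gamma * x)) <= expR e * expR (- (theta rho * x))].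
  by near: x; apply: near_lundberg_exponent => //; rewrite mulr1.
move=> /(_ rho rho01 th) [gamma [g0 g1 g2]]; apply: le_trans g2.
rewrite mul1r in g1.
exact: (lundberg_bound nu_pos rho01 (u_sol rho01) g0 (ltW x0) g1).
Unshelve. all: by end_near. Qed.

Lemma near_H_scale l e : 0 < l -> 0 < e ->
  \forall x \near +oo, H (l * x) <= (l `^ (1 - alpha) + e) * H x.
Proof.
move=> l0 e0; near=> x.
rewrite -ler_pdivrMr//; near: x.
by have := H_rv l0; move/cvgr_le; apply; rewrite ltrDl.
Unshelve. all: by end_near. Qed.

(** For [k = a] the jumps must be truncated lower, here at [x / 2]. Larger jumps
    are accounted for separately: their probability is [O (H x / (1 - rho))],
    where [1 - rho] is comparable to [T x], and the hypothesis makes this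
    negligible against [x `^ (- a) <= expR (- (theta rho * x))]. *)
Lemma exponential_upper_critical e : 0 < e ->
  (forall K, 0 < K -> \forall x \near +oo, x `^ (alpha - 1) * H x <= K * ln x) ->
  \forall x \near +oo, forall rho, 0 < rho < 1 ->
    a / 2 * T x <= theta rho <= a * T x ->
    u rho x <= (expR e + e) * expR (- (theta rho * x)).
Proof.
move=> e0 HL; have a0 : 0 < a by rewrite subr_gt0.
have h2 : 0 < 2^-1 :> R by rewrite invr_gt0.
pose c := 2^-1 `^ (1 - alpha) + 1 : R.
have c0 : 0 < c by rewrite /c ltr_wpDl ?powR_ge0.
pose K := e * (mu * a / 2) / (5 * c).
have K0 : 0 < K by rewrite !(divr_gt0, mulr_gt0).
near=> x => rho rho01 /andP[th1 th2].
have /andP[rho0 rho1] := rho01.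
have x0 : 0 < x by near: x; exact: nbhs_pinfty_gt.
have l1 : 1 <= ln x by near: x; exact: near_ln_ge.
have t0 : 0 < T x by rewrite divr_gt0// (lt_le_trans ltr01).
have : forall rho, 0 < rho < 1 -> theta rho <= a * T x ->
    exists gamma, [/\ 0 <= gamma, rho * mgf_trunc nu gamma (2^-1 * x) <= 1 &
      expR (- (gamma * x)) <= expR e * expR (- (theta rho * x))].
  by near: x; apply: near_lundberg_exponent => //; rewrite ltr_pdivrMr//; lra.
move=> /(_ rho rho01 th2) [gamma [g0 g1 g2]].
pose z := 2^-1 * x.
have z0 : 0 <= z by rewrite mulr_ge0// ltW.
have d1 : rho * mgf_trunc nu 0 z <= (1 + rho) / 2 by rewrite mgf_trunc0; move: rho1; lra_alone.
have zz : z + z <= x by rewrite /z; lra_alone.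
have := big_jump_upper nu_pos rho01 (u_sol rho01) g0 (lexx 0) z0 (lexx z) zz g1 d1.
move=> /le_trans; apply; rewrite [leRHS]mulrDl; apply: lerD.
  by apply: le_trans g2; rewrite ler_piMl ?expR_ge0.
rewrite mul0r oppr0 expR0.
have uz1 : u rho z <= 1 by have [_ /(_ z) /andP[]] := u_sol rho01.
have Hz := survival_ge0 nu z.
have hz : H (2^-1 * x) <= c * H x by near: x; exact: (near_H_scale h2 ltr01).
have b1 : H z + 2 * H z * (u rho z + 1) <= 5 * (c * H x).
  apply: (@le_trans _ _ (5 * H z)).
    have huz : H z * u rho z <= H z * 1 by rewrite ler_wpM2l.
    move: huz Hz; lra_alone.
  by rewrite ler_wpM2l.
have r1 : 0 < 1 - rho by rewrite subr_gt0.
have tt : 0 < mu * (a / 2 * T x) by rewrite mulr_gt0// mulr_gt0// mulr_gt0.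
apply: (@le_trans _ _ ((mu * (a / 2 * T x))^-1 * (5 * (c * H x)))).
  apply: ler_pM => //.
  - by rewrite divr_ge0 ?(ltW r1) ?(ltW rho0).
  - rewrite addr_ge0// !mulr_ge0// addr_ge0//.
    by have [_ /(_ z) /andP[]] := u_sol rho01.
  - apply: (@le_trans _ _ (1 - rho)^-1).
      by rewrite ler_piMl ?invr_ge0 ?(ltW r1) ?(ltW rho1).
    rewrite lef_pV2 ?posrE//.
    by rewrite -decay_rateM mulrC ler_wpM2r ?(ltW mu0).
have xa : x `^ (alpha - 1) = x * x `^ a.
  rewrite -[X in X * _]powRr1 ?(ltW x0)// -powRD ?(gt_eqF x0) ?implybT//.
  by congr (_ `^ _); ring.
have HLx : x `^ (alpha - 1) * H x <= K * ln x by near: x; exact: HL.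
have hth : x `^ (- a) <= expR (- (theta rho * x)).
  rewrite powR_expR// ler_expR mulNr lerN2 -(log_rate_mul x0) mulrA.
  by rewrite ler_wpM2r ?(ltW x0).
apply: (@le_trans _ _ (e * x `^ (- a))); last by rewrite ler_wpM2l ?(ltW e0).
have pa : 0 < x `^ a by exact: powR_gt0.
have hH : H x <= K * T x * x `^ (- a).
  rewrite powRN ler_pdivlMr// /log_rate mulrA ler_pdivlMr//.
  by move: HLx; rewrite xa; congr (_ <= _); ring.
have -> : e * x `^ (- a) =
    (mu * (a / 2 * T x))^-1 * (5 * (c * (K * T x * x `^ (- a)))).
  rewrite /K; field; rewrite !gt_eqF//.
rewrite ler_wpM2l ?invr_ge0 ?(ltW tt)//.
by rewrite ler_wpM2l// ler_wpM2l// ltW.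
Unshelve. all: by end_near. Qed.

(** [truncated_exponential_lower] at the level [K = x `^ 2^-1]: large enough for
    [mean_trunc nu K] to be close to [mu], small enough for [theta rho * K] to
    vanish. *)
Lemma exponential_lower k e : 0 < k -> 0 < e ->
  \forall x \near +oo, forall rho, 0 < rho < 1 -> theta rho <= k * T x ->
    expR (- e) * expR (- (theta rho * x)) <= u rho x.
Proof.
move=> k0 e0; have [s [M [s0 M0 HM]]] := mean_bound.
have M1 : 0 < M + 1 by lra.
have h2 : 0 < 2^-1 :> R by rewrite invr_gt0.
have e4 : 0 < e / 3 by rewrite divr_gt0.
near=> x => rho rho01 th; have /andP[rho0 rho1] := rho01.
have x0 : 0 < x by near: x; exact: nbhs_pinfty_gt.
have l1 : 1 <= ln x by near: x; exact: near_ln_ge.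
have t0 : 0 < T x by rewrite divr_gt0// (lt_le_trans ltr01).
have th0 := decay_rate_gt0 rho1.
have thx : theta rho * x <= k * ln x.
  by rewrite -(log_rate_mul x0) mulrA ler_wpM2r// ltW.
pose K := x `^ 2^-1.
have K0 : 0 < K by exact: powR_gt0.
have hK := HM K K0; set mK := mean_trunc nu K in hK *.
have KE : M * K `^ (- s) = M * x `^ (- (s / 2)).
  by rewrite /K -powRrM; congr (_ * _ `^ _); field.
have n1 : M * x `^ (- (s / 2)) <= mu / 2.
  by near: x; apply: near_powR_le; rewrite ?divr_gt0.
have mK2 : mu / 2 <= mK by rewrite KE in hK; move: hK n1; lra_alone.
have rho2 : 2^-1 <= rho.
  have : forall rho, theta rho <= k * T x -> 1 - rho <= 2^-1.
    by near: x; exact: near_rho_ge.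
  move/(_ rho th); lra_alone.
have rm : mu / 4 <= rho * mK.
  have : 2^-1 * (mu / 2) <= rho * mK.
    by apply: ler_pM => //; rewrite ?divr_ge0 ?(ltW mu0) ?(ltW h2).
  lra_alone.
have rm0 : 0 < rho * mK by apply: lt_le_trans rm; rewrite divr_gt0.
have mK0 : mK != 0 by rewrite gt_eqF// (lt_le_trans _ mK2)// divr_gt0.
have rn : rho != 0 by rewrite gt_eqF.
pose g := theta rho * mu / (rho * mK).
have g0 : 0 <= g by rewrite divr_ge0 ?(ltW rm0)// mulr_ge0 ?(ltW th0) ?(ltW mu0).
have g4 : g <= 4 * theta rho.
  rewrite /g ler_pdivrMr//.
  have := ler_wpM2l (ltW th0) rm; lra_alone.
have key : 1 <= rho * (1 + g * mK).
  have -> : rho * (1 + g * mK) = rho + theta rho * mu.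
    by rewrite /g; field; rewrite rn mK0.
  by rewrite decay_rateM; lra_alone.
apply: le_trans (truncated_exponential_lower nu_pos rho01 (u_sol rho01) g0 (ltW K0) (ltW x0) key).
rewrite -expRD ler_expR -opprD lerN2.
have gd : (g - theta rho) * x <= 4 / mu * (M * x `^ (- (s / 2)) + theta rho * mu * mu) * (k * ln x).
  have -> : (g - theta rho) * x = (mu - rho * mK) / (rho * mK) * (theta rho * x).
    by rewrite /g; field; rewrite rn mK0.
  have hm : mK <= mu by exact: mean_le.
  have d1 : mu - rho * mK <= M * x `^ (- (s / 2)) + theta rho * mu * mu.
    rewrite decay_rateM -KE.
    have h : (1 - rho) * mK <= (1 - rho) * mu by rewrite ler_wpM2l// subr_ge0 ltW.
    move: h hK; lra_alone.
  have d0 : 0 <= M * x `^ (- (s / 2)) + theta rho * mu * mu.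
    have tm : 0 <= theta rho * mu by rewrite decay_rateM subr_ge0 ltW.
    apply: addr_ge0; first exact: mulr_ge0 (powR_ge0 _ _).
    exact: mulr_ge0 (ltW mu0).
  have tx0 : 0 <= theta rho * x by rewrite mulr_ge0 ?(ltW th0) ?(ltW x0).
  apply: ler_pM => //.
    rewrite divr_ge0 ?(ltW rm0)// subr_ge0 (le_trans _ hm)// ler_piMl ?(ltW rho1)//.
    by rewrite (le_trans _ mK2)// divr_ge0 ?(ltW mu0).
  apply: (@le_trans _ _ ((M * x `^ (- (s / 2)) + theta rho * mu * mu) / (rho * mK))).
    by rewrite ler_wpM2r ?invr_ge0 ?(ltW rm0).
  rewrite mulrC ler_wpM2r// -[4 / mu]invf_div lef_pV2 ?posrE ?divr_gt0//.
have gK : g * K <= e / 3.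
  have -> : e / 3 = 4 * (e / 12) by field.
  apply: (@le_trans _ _ (4 * theta rho * K)); first by rewrite ler_wpM2r ?(ltW K0).
  rewrite -mulrA ler_wpM2l//.
  apply: (@le_trans _ _ (k * T x * K)); first by rewrite ler_wpM2r ?(ltW K0).
  have -> : k * T x * K = k * ln x * x `^ (- 2^-1).
    rewrite /log_rate /K -(powR_inv1 (ltW x0)) -!mulrA; congr (_ * (_ * _)).
    by rewrite -powRD ?(gt_eqF x0) ?implybT//; congr (_ `^ _); field.
  by near: x; apply: near_ln_powR_le; rewrite ?divr_gt0// ltW.
have e1 : 4 / mu * k * M * ln x * x `^ (- (s / 2)) <= e / 3.
  by near: x; apply: near_ln_powR_le; rewrite ?divr_gt0// !mulr_ge0 ?invr_ge0 ?(ltW mu0) ?(ltW k0).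
have e2 : 4 * k * k * mu * ((ln x * x `^ (- 2^-1)) * (ln x * x `^ (- 2^-1))) <= e / 3.
  have l2 : ln x * x `^ (- 2^-1) <= 1.
    rewrite -[X in X * _]mul1r; near: x; exact: near_ln_powR_le.
  have l0 : 0 <= ln x * x `^ (- 2^-1).
    by rewrite mulr_ge0 ?powR_ge0// (le_trans ler01).
  apply: (@le_trans _ _ (4 * k * k * mu * ln x * x `^ (- 2^-1))).
    rewrite -[leRHS]mulrA ler_wpM2l ?mulr_ge0 ?(ltW k0) ?(ltW mu0)//.
    by rewrite ler_piMl.
  by near: x; apply: near_ln_powR_le; rewrite ?divr_gt0// !mulr_ge0 ?(ltW mu0) ?(ltW k0).
have gx : (g - theta rho) * x <= e / 3 + e / 3.
  apply: (le_trans gd); rewrite mulrDr mulrDl lerD//.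
    by move: e1; congr (_ <= _); ring.
  apply: le_trans e2.
  have xx : x `^ (- 2^-1) * x `^ (- 2^-1) = x^-1.
    rewrite -powRD ?(gt_eqF x0) ?implybT// -(powR_inv1 (ltW x0)).
    by congr (_ `^ _); field.
  have -> : 4 * k * k * mu * ((ln x * x `^ (- 2^-1)) * (ln x * x `^ (- 2^-1))) =
            4 / mu * (k * T x * mu * mu) * (k * ln x).
    rewrite [X in _ * _ * X = _](_ : _ = ln x * ln x * (x `^ (- 2^-1) * x `^ (- 2^-1))); last by ring.
    by rewrite xx /log_rate; field; rewrite !gt_eqF.
  rewrite ler_wpM2r ?mulr_ge0 ?(ltW k0) ?(le_trans ler01 l1)//.
  rewrite ler_wpM2l ?divr_ge0 ?(ltW mu0)//.
  by rewrite ler_wpM2r ?(ltW mu0)// ler_wpM2r ?(ltW mu0).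
move: gx gK; lra_alone.
Unshelve. all: by end_near. Qed.

(** In this range [H x / (1 - rho)] tends to 0, so that the denominator in
    [single_jump_lower] is close to [1 - rho]. *)
Lemma heavy_tail_lower k e : 0 < k -> 0 < e ->
  \forall x \near +oo, forall rho, 0 < rho < 1 -> k * T x <= theta rho ->
    rho / (1 - rho) * H x <= (1 + e) * u rho x.
Proof.
move=> k0 e0; have rr : 0 < alpha / 2 < alpha - 1 by move: alpha2 => ?; apply/andP; split; lra.
have [C C0 HC] := H_upper rr.
near=> x => rho rho01 th; have /andP[rho0 rho1] := rho01.
have x0 : 0 < x by near: x; exact: nbhs_pinfty_gt.
have x1 : 1 <= x by near: x; exact: nbhs_pinfty_ge.
have l1 : 1 <= ln x by near: x; exact: near_ln_ge.
have r0 : 0 < 1 - rho by rewrite subr_gt0.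
have h1 : C * x `^ (- (alpha / 2 - 1)) <= e * (mu * k).
  by near: x; apply: near_powR_le; rewrite ?mulr_gt0//; move: alpha2 => ?; lra.
have h2 : H x <= e * (1 - rho).
  apply: (le_trans (HC x x1)).
  have -> : x `^ (- (alpha / 2)) = x `^ (- (alpha / 2 - 1)) * x^-1.
    rewrite -(powR_inv1 (ltW x0)) -powRD ?(gt_eqF x0) ?implybT//.
    by congr (_ `^ _); ring.
  rewrite mulrA; apply: (@le_trans _ _ (e * (mu * k) * x^-1)).
    by rewrite ler_wpM2r// invr_ge0 ltW.
  rewrite -decay_rateM -mulrA ler_wpM2l ?(ltW e0)//.
  have -> : mu * k * x^-1 = k * x^-1 * mu by ring.
  rewrite ler_wpM2r ?(ltW mu0)//; apply: le_trans th.
  by rewrite ler_wpM2l ?(ltW k0)// /log_rate ler_peMl// invr_ge0 ltW.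
have Hx := H_gt0 x.
have den0 : 0 < 1 - rho + rho * H x by rewrite addr_gt0// mulr_gt0.
have e1 : 0 <= 1 + e by rewrite addr_ge0 ?(ltW e0).
apply: le_trans (ler_wpM2l e1 (single_jump_lower nu_pos rho01 (u_sol rho01) (ltW x0))).
have -> : rho / (1 - rho) * H x = rho * H x / (1 - rho) by ring.
rewrite mulrA ler_pdivlMr// mulrAC ler_pdivrMr//.
have -> : (1 + e) * (rho * H x) * (1 - rho) = rho * H x * ((1 + e) * (1 - rho)) by ring.
rewrite ler_wpM2l ?(ltW (mulr_gt0 rho0 Hx))//.
have h3 : rho * H x <= H x by rewrite ler_piMl ?(ltW Hx) ?(ltW rho1).
move: h2 h3; lra_alone.
Unshelve. all: by end_near. Qed.

Lemma near_scale_limit e : 0 < e -> exists2 l : R, 0 < l < 1 &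
  forall l', l <= l' -> l' `^ (1 - alpha) <= 1 + e.
Proof.
move=> e0; have a1 : 0 < alpha - 1 by move: alpha2 => ?; lra.
have e1 : 0 < 1 + e by lra.
pose l := (1 + e) `^ (- (alpha - 1)^-1).
have l0 : 0 < l by exact: powR_gt0.
exists l; first apply/andP; first split => //.
  rewrite /l powR_expR// expR_lt1 nmulr_rlt0 ?ln_gt0 ?oppr_lt0 ?invr_gt0//; lra.
move=> l' ll; have l'0 : 0 < l' by exact: lt_le_trans ll.
have -> : 1 + e = l `^ (1 - alpha).
  rewrite /l -powRrM -[LHS]powRr1 ?(ltW e1)//; congr (_ `^ _).
  by field; rewrite gt_eqF.
have -> : 1 - alpha = - (alpha - 1) by ring.
rewrite !powRN lef_pV2 ?posrE ?powR_gt0//.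
by rewrite ge0_ler_powR ?nnegrE ?(ltW l0) ?(ltW l'0) ?(ltW a1).
Qed.

(** The paths without large jumps are negligible against a single large jump.
    As long as [theta = theta rho] is of order [T x], their probability is about
    [expR (- (theta * x))], and [theta * expR (- (theta * x))], decreasing in
    [theta] beyond [1 / x], is compared with its value at [k * T x], where the
    hypothesis applies. For larger [theta] the fixed exponent [alpha * T x] gives
    [x `^ (- alpha)], which is negligible against [H x]. *)
Lemma near_exponential_term_negligible k b e : 0 < k -> 0 < b ->
  2 * alpha * b < a -> 0 < e ->
  (forall K, 0 < K -> \forall x \near +oo, K * ln x <= x `^ (1 + k) * H x) ->
  \forall x \near +oo, forall rho, 0 < rho < 1 -> k * T x <= theta rho ->
    exists gamma, [/\ 0 <= gamma, rho * mgf_trunc nu gamma (b * x) <= 1 &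
      rho * mgf_trunc nu gamma (b * x) * expR (- (gamma * x)) <=
        e * (rho / (1 - rho) * H x)].
Proof.
move=> k0 b0 b3 e0 HQ.
have al0 : 0 < alpha by rewrite (lt_trans _ alpha2).
have al2 : 0 < 2 * alpha by rewrite mulr_gt0.
have ab0 : 0 < alpha * b by rewrite mulr_gt0.
have b5 : alpha * b < a.
  apply: lt_trans b3; rewrite -mulrA; move: ab0; lra_alone.
have h2 : 0 < 2^-1 :> R by rewrite invr_gt0.
have rr : alpha - 1 < alpha - 2^-1 by rewrite ltrD2l ltrN2 invf_lt1// ltr1n.
have [c c0 Hc] := H_lower rr.
have ln2 : 0 < ln 2 :> R by rewrite ln_gt0// ltr1n.
pose K := 4 * k * mu / e.
have K0 : 0 < K by rewrite divr_gt0// !mulr_gt0.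
near=> x => rho rho01 th; have /andP[rho0 rho1] := rho01.
have x0 : 0 < x by near: x; exact: nbhs_pinfty_gt.
have l1 : 1 <= ln x by near: x; exact: near_ln_ge.
have lk : k^-1 <= ln x by near: x; exact: near_ln_ge.
have t0 : 0 < T x by rewrite divr_gt0// (lt_le_trans ltr01).
have r0 : 0 < 1 - rho by rewrite subr_gt0.
have Hx := H_gt0 x.
have eH : 0 <= e * H x by rewrite mulr_ge0 ?(ltW e0) ?(ltW Hx).
have [thA|thB] := leP (theta rho) (2 * alpha * T x).
  have : forall rho, 0 < rho < 1 -> theta rho <= 2 * alpha * T x ->
    exists gamma, [/\ 0 <= gamma, rho * mgf_trunc nu gamma (b * x) <= 1 &
      expR (- (gamma * x)) <= expR (ln 2) * expR (- (theta rho * x))].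
    by near: x; exact: near_lundberg_exponent.
  move=> /(_ rho rho01 thA) [gamma [g0 g1 g2]].
  exists gamma; split => //.
  apply: (@le_trans _ _ (expR (- (gamma * x)))); first by rewrite ler_piMl ?expR_ge0.
  apply: (le_trans g2); rewrite lnK ?posrE//.
  have rho2 : 2^-1 <= rho.
    have : forall rho, theta rho <= 2 * alpha * T x -> 1 - rho <= 2^-1.
      by near: x; exact: near_rho_ge.
    move/(_ rho thA); lra_alone.
  have HQx : K * ln x <= x `^ (1 + k) * H x by near: x; exact: HQ.
  have kl : 1 <= k * ln x by rewrite mulrC -ler_pdivrMr// mul1r.
  have klt : k * ln x <= theta rho * x.
    by rewrite -(log_rate_mul x0) mulrA ler_wpM2r ?(ltW x0).
  have main := mul_expRN_le kl klt.
  have xk : expR (- (k * ln x)) = x `^ (- k) by rewrite powR_expR// mulNr.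
  rewrite xk in main.
  have pk : 0 < x `^ k by exact: powR_gt0.
  have main2 : (1 - rho) * expR (- (theta rho * x)) <= mu * k * T x * x `^ (- k).
    rewrite -decay_rateM -(ler_pM2r x0).
    have -> : theta rho * mu * expR (- (theta rho * x)) * x =
              mu * (theta rho * x * expR (- (theta rho * x))) by ring.
    have -> : mu * k * T x * x `^ (- k) * x = mu * (k * ln x * x `^ (- k)).
      by rewrite -(log_rate_mul x0); ring.
    by rewrite ler_wpM2l ?(ltW mu0).
  have main3 : 4 * (mu * k * T x * x `^ (- k)) <= e * H x.
    rewrite powRN -(ler_pM2r pk) -(ler_pM2r x0).
    have -> : 4 * (mu * k * T x * (x `^ k)^-1) * x `^ k * x = e * (K * ln x).
      by rewrite -(log_rate_mul x0) /K; field; rewrite !gt_eqF.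
    have -> : e * H x * x `^ k * x = e * (x `^ (1 + k) * H x).
      by rewrite powRD ?(gt_eqF x0) ?implybT// powRr1 ?(ltW x0)//; ring.
    by rewrite ler_wpM2l ?(ltW e0).
  have -> : e * (rho / (1 - rho) * H x) = rho * (e * H x) / (1 - rho) by ring.
  rewrite ler_pdivlMr//.
  have main4 : 2^-1 * (e * H x) <= rho * (e * H x) by rewrite ler_wpM2r.
  move: main2 main3 main4; lra_alone.
have aT : 0 <= alpha * T x by rewrite mulr_ge0 ?(ltW al0) ?(ltW t0).
have mg : mgf_trunc nu (alpha * T x) (b * x) <= 1 + 2 * (alpha * T x) * mu.
  by near: x; exact: near_mgf_le.
exists (alpha * T x); split => //.
  apply: le_trans (rho_mul_le1 rho); rewrite ler_wpM2l ?(ltW rho0)//.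
  rewrite (le_trans mg)// lerD2l ler_wpM2r ?(ltW mu0)//.
  by rewrite mulrA ltW.
have small : 2 * alpha * mu * T x <= 1.
  by near: x; apply: near_log_rate_le => //; rewrite !mulr_ge0 ?(ltW al0) ?(ltW mu0).
have mg2 : mgf_trunc nu (alpha * T x) (b * x) <= 2.
  by move: mg small; lra_alone.
have xal : expR (- (alpha * T x * x)) = x `^ (- (alpha - 2^-1)) * x `^ (- 2^-1).
  rewrite -powRD ?(gt_eqF x0) ?implybT// powR_expR//; congr expR.
  by rewrite -mulrA (log_rate_mul x0); field.
have hc : c * x `^ (- (alpha - 2^-1)) <= H x by near: x; exact: Hc.
have hc2 : 2 * x `^ (- 2^-1) <= e * c.
  by near: x; apply: near_powR_le => //; rewrite mulr_gt0.
rewrite -mulrA.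
have -> : e * (rho / (1 - rho) * H x) = rho * (e * ((1 - rho)^-1 * H x)) by ring.
rewrite ler_wpM2l ?(ltW rho0)//.
apply: (@le_trans _ _ (2 * expR (- (alpha * T x * x)))).
  by rewrite ler_wpM2r// expR_ge0.
rewrite xal.
apply: (@le_trans _ _ (e * H x)).
  have -> : 2 * (x `^ (- (alpha - 2^-1)) * x `^ (- 2^-1)) =
    x `^ (- (alpha - 2^-1)) * (2 * x `^ (- 2^-1)) by ring.
  apply: (@le_trans _ _ (x `^ (- (alpha - 2^-1)) * (e * c))).
    by rewrite ler_wpM2l// powR_ge0.
  have -> : x `^ (- (alpha - 2^-1)) * (e * c) = e * (c * x `^ (- (alpha - 2^-1))) by ring.
  by rewrite ler_wpM2l ?(ltW e0).
rewrite ler_wpM2l ?(ltW e0)// ler_peMl ?(ltW Hx)//.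
by rewrite invf_ge1// gerBl ltW.
Unshelve. all: by end_near. Qed.

(** [big_jump_upper] with [z = b * x] and threshold [(1 - 2 * b) * x]: for small
    [b] regular variation makes [H ((1 - 2 * b) * x)] close to [H x], a jump
    between the two thresholds costs [O(H x)] times a negative power of [x], and
    [near_exponential_term_negligible] disposes of the paths without large jump. *)
Lemma heavy_tail_upper k e : 0 < k -> 0 < e ->
  (forall K, 0 < K -> \forall x \near +oo, K * ln x <= x `^ (1 + k) * H x) ->
  \forall x \near +oo, forall rho, 0 < rho < 1 -> k * T x <= theta rho ->
    u rho x <= (1 + e) * (rho / (1 - rho) * H x).
Proof.
move=> k0 e0 HQ; have a0 : 0 < a by rewrite subr_gt0.
have al0 : 0 < alpha by rewrite (lt_trans _ alpha2).
have e4 : 0 < e / 4 by rewrite divr_gt0.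
have [l /andP[l0 l1] Hl] := near_scale_limit e4.
pose b := Num.min ((1 - l) / 2) (Num.min 3^-1 (Num.min (a / (4 * alpha)) (2 * a / k))).
have b0 : 0 < b.
  have q1 : 0 < (1 - l) / 2 by rewrite divr_gt0// subr_gt0.
  have q2 : 0 < 3^-1 :> R by rewrite invr_gt0.
  have q3 : 0 < a / (4 * alpha) by rewrite divr_gt0// mulr_gt0.
  have q4 : 0 < 2 * a / k by rewrite divr_gt0// mulr_gt0.
  by rewrite !lt_min q1 q2 q3 q4.
have b1 : b <= (1 - l) / 2 by rewrite ge_min lexx.
have b2 : b <= 3^-1 by rewrite !ge_min lexx ?orbT.
have b3 : 2 * alpha * b < a.
  have : b <= a / (4 * alpha) by rewrite !ge_min lexx ?orbT.
  rewrite ler_pdivlMr ?mulr_gt0// => h; move: a0 h; lra_alone.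
have b4 : k / 4 * b < a.
  have : b <= 2 * a / k by rewrite !ge_min lexx ?orbT.
  rewrite ler_pdivlMr// => h; move: a0 h; lra_alone.
pose b' := 1 - 2 * b.
have lb' : l <= b' by rewrite /b'; move: b1; lra_alone.
have b'0 : 0 < b' by exact: lt_le_trans lb'.
have bb' : b <= b' by rewrite /b'; move: b2; lra_alone.
pose cb := b `^ (1 - alpha) + 1.
have cb0 : 0 < cb by rewrite /cb ltr_wpDl ?powR_ge0.
have k4 : 0 < k / 4 by rewrite divr_gt0.
near=> x => rho rho01 th; have /andP[rho0 rho1] := rho01.
have x0 : 0 < x by near: x; exact: nbhs_pinfty_gt.
have l1x : 1 <= ln x by near: x; exact: near_ln_ge.
have t0 : 0 < T x by rewrite divr_gt0// (lt_le_trans ltr01).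
have r0 : 0 < 1 - rho by rewrite subr_gt0.
have Hx := H_gt0 x.
pose z := b * x.
have z0 : 0 < z by rewrite mulr_gt0.
have zb : z <= b' * x by rewrite /z ler_wpM2r ?(ltW x0).
have xz : x - b' * x - z = z by rewrite /z /b'; ring.
have zx : b' * x + z <= x by rewrite -subr_ge0 opprD addrA xz ltW.
pose delta := k / 4 * T x.
have d0 : 0 <= delta by rewrite mulr_ge0 ?(ltW k4) ?(ltW t0).
have mgfd : mgf_trunc nu delta z <= 1 + 2 * delta * mu.
  by rewrite /delta /z; near: x; exact: near_mgf_le.
have mgfd2 : rho * mgf_trunc nu delta z <= (1 + rho) / 2.
  apply: (@le_trans _ _ (rho * (1 + (1 - rho) / 2))).
    rewrite ler_wpM2l ?(ltW rho0)// (le_trans mgfd)// lerD2l -decay_rateM.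
    have -> : 2 * delta * mu = k * T x * mu / 2 by rewrite /delta; field.
    by rewrite ler_wpM2r// ler_wpM2r ?(ltW mu0).
  have h : 0 <= (1 - rho) * (1 - rho) by rewrite mulr_ge0 ?(ltW r0).
  move: h; lra_alone.
have uz : u rho z <= expR (- (delta * z)).
  apply: (lundberg_bound nu_pos rho01 (u_sol rho01) d0 (ltW z0)).
  rewrite (le_trans mgfd2)//; move: rho1; lra_alone.
have : forall rho, 0 < rho < 1 -> k * T x <= theta rho ->
    exists gamma, [/\ 0 <= gamma, rho * mgf_trunc nu gamma (b * x) <= 1 &
      rho * mgf_trunc nu gamma (b * x) * expR (- (gamma * x)) <=
        e / 4 * (rho / (1 - rho) * H x)].
  by near: x; exact: near_exponential_term_negligible.
move=> /(_ rho rho01 th) [gamma [g0 g1 g2]].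
have jump := big_jump_upper nu_pos rho01 (u_sol rho01) g0 d0 (ltW z0) zb zx g1 mgfd2.
rewrite xz in jump.
have Hb : H (b' * x) <= (b' `^ (1 - alpha) + e / 4) * H x.
  by near: x; exact: near_H_scale.
have HB : H (b' * x) <= (1 + e / 2) * H x.
  have Hb2 := Hl b' lb'.
  apply: (le_trans Hb); rewrite ler_wpM2r ?(ltW Hx)//; move: Hb2; lra_alone.
have Hz : H z <= cb * H x by rewrite /z /cb; near: x; exact: near_H_scale.
have ed : expR (- (delta * z)) = x `^ (- (k * b / 4)).
  by rewrite powR_expR// /delta /z -(log_rate_mul x0); congr expR; field.
have small : 4 * cb * x `^ (- (k * b / 4)) <= e / 4.
  near: x; apply: near_powR_le => //; first by rewrite mulr_ge0 ?(ltW cb0).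
  by rewrite divr_gt0// mulr_gt0.
have bracket : H (b' * x) + 2 * H z * (u rho z + expR (- (delta * z))) <=
    (1 + e / 2 + e / 4) * H x.
  have s1 : 2 * H z * (u rho z + expR (- (delta * z))) <=
      2 * (cb * H x) * (2 * x `^ (- (k * b / 4))).
    rewrite -ed; apply: ler_pM.
    - by rewrite mulr_ge0// survival_ge0.
    - by rewrite addr_ge0 ?expR_ge0//; have [_ /(_ z) /andP[]] := u_sol rho01.
    - by rewrite ler_wpM2l.
    - by move: uz; lra_alone.
  have s2 : 2 * (cb * H x) * (2 * x `^ (- (k * b / 4))) <= e / 4 * H x.
    have -> : 2 * (cb * H x) * (2 * x `^ (- (k * b / 4))) =
       4 * cb * x `^ (- (k * b / 4)) * H x by ring.
    by rewrite ler_wpM2r ?(ltW Hx).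
  rewrite [leRHS]mulrDl; apply: lerD => //; exact: le_trans s2.
have rr0 : 0 <= rho / (1 - rho) by rewrite divr_ge0 ?(ltW rho0) ?(ltW r0).
apply: (le_trans jump).
have split3 : (1 + e) * (rho / (1 - rho) * H x) =
    e / 4 * (rho / (1 - rho) * H x) +
    rho / (1 - rho) * ((1 + e / 2 + e / 4) * H x) by field; rewrite gt_eqF.
by rewrite split3; apply: lerD => //; rewrite ler_wpM2l.
Unshelve. all: by end_near. Qed.

End uniform_estimates.

(** * The transition from heavy traffic to heavy tails *)

Section assembly.
Context (R : realType).

(** Non-emptiness of [D x] matters: the supremum of the empty set is [-oo]. *)
Lemma uniformly_asymp_equiv_near (D : R -> set R) (f h : R -> R -> R) :
  (forall e : R, 0 < e -> \forall x \near +oo, D x !=set0 /\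
     forall rho, D x rho -> `| f rho x / h rho x - 1 | <= e) ->
  uniformly_asymp_equiv D f h.
Proof.
move=> H; set s := fun x => ereal_sup
  [set (`| f rho x / h rho x - 1 |)%:E | rho in D x].
have bnd e : 0 < e -> \forall x \near +oo, (0 <= s x <= e%:E)%E.
  move=> e0; apply: filterS (H e e0) => x [[rho Drho] Hx]; apply/andP; split.
    apply: (@le_trans _ _ (`| f rho x / h rho x - 1 |)%:E).
      by rewrite lee_fin.
    by apply: ereal_sup_ubound; exists rho.
  by apply: ge_ereal_sup => _ [r Dr <-]; rewrite lee_fin Hx.
apply/fine_cvgP; split.
  apply: filterS (bnd 1 ltr01) => x /andP[s0 s1].
  by rewrite ge0_fin_numE// (le_lt_trans s1) ?ltry.
apply/cvgrPdist_le => e e0; apply: filterS (bnd e e0) => x /andP[s0 s1].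
have sfin : s x \is a fin_num by rewrite ge0_fin_numE// (le_lt_trans s1) ?ltry.
by rewrite /= sub0r normrN ger0_norm ?fine_ge0// -lee_fin fineK.
Qed.

Lemma ratio_dist_le (f h e : R) : 0 < h -> (1 - e) * h <= f -> f <= (1 + e) * h ->
  `| f / h - 1 | <= e.
Proof.
move=> h0 lo up; rewrite distrC ler_distlC.
by rewrite ler_pdivlMr// ler_pdivrMr// lo up.
Qed.

Lemma small_exponent (e : R) : 0 < e ->
  exists2 d, 0 < d & expR d + d <= 1 + e /\ 1 - e <= expR (- d).
Proof.
move=> e0; have e2 : 0 < e / 2 by rewrite divr_gt0.
have l0 : 0 < ln (1 + e / 2) by rewrite ln_gt0// ltrDl.
pose d := Num.min (ln (1 + e / 2)) (e / 2).
exists d; first by rewrite lt_min l0.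
have d1 : d <= ln (1 + e / 2) by rewrite ge_min lexx.
have d2 : d <= e / 2 by rewrite ge_min lexx orbT.
split; last by have := expR_ge1Dx (- d); lra.
have : expR d <= 1 + e / 2 by rewrite -[leRHS]lnK ?posrE ?ler_expR//; lra.
lra.
Qed.

End assembly.

Lemma tail_survival (R : realType) (d : measure_display) (T : measurableType d)
  (P : probability T R) (Y : {RV P >-> R}) : tail Y = survival (distribution P Y).
Proof.
apply/funext => x; rewrite /tail /survival; congr (fine (P _)).
by apply/seteqP; split => t /=; rewrite in_itv/= andbT.
Qed.

Theorem corollary2p4
  (R : realType) (d : measure_display) (T : measurableType d)
  (P : probability T R)
  (V X : {RV P >-> R}) (A W : R -> {RV P >-> R})
  (L : R -> R) (alpha c kappa : R) (rhohat : R -> R)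
  (V_ge0 : forall t, 0 <= V t)
  (A_exp : forall rho, 0 < rho < 1 ->
    exponentially_distributed (A rho) (rho / mean V))
  (W_steady : forall rho, 0 < rho < 1 ->
    steady_state_waiting_time V (A rho) (W rho))
  (X_density : has_density_on_pos X (fun t => tail V t / mean V))
  (L_slow : slowly_varying L)
  (alpha_gt2 : 2 < alpha)
  (V_tail : asymp_equiv (tail V) (fun x => L x * x `^ (- alpha)))
  (kappaE : kappa = (alpha - 2) * second_moment V / (2 * mean V))
  (c_gt0 : 0 < c)
  (rhohatE : forall x, 0 < x -> rhohat x = 1 - c * kappa * (ln x / x)) :
  let heavy_traffic :=
    uniformly_asymp_equiv (fun x => [set rho | rhohat x <= rho < 1])
      (fun rho x => tail (W rho) x)
      (fun rho x => expR (- (2 * (1 - rho) * mean V * x / second_moment V))) in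
  let heavy_tail :=
    uniformly_asymp_equiv (fun x => [set rho | 0 < rho <= rhohat x])
      (fun rho x => tail (W rho) x)
      (fun rho x => rho / (1 - rho) * tail X x) in
  [/\ c < 1 -> heavy_traffic,
      c = 1 -> L x / ln x @[x --> +oo] --> (0 : R) -> heavy_traffic,
      1 < c -> heavy_tail
    & c = 1 -> L x / ln x @[x --> +oo] --> +oo -> heavy_tail].
Proof.
pose v := distribution P V; pose nu := distribution P X.
pose m := mean V.
have tailV := tail_survival V; have tailX := tail_survival X.
rewrite -/v in tailV; rewrite -/nu in tailX.
have [[aL [mL L_gt0]] L_sv] := L_slow.
have L_pos : \forall x \near +oo, 0 < L x by exists aL; split => //; exact: num_real.
have V_ratio : \forall x \near +oo,
    2^-1 <= survival v x / (L x * x `^ (- alpha)) <= 2.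
  have V_tail' := V_tail; rewrite /asymp_equiv tailV in V_tail'.
  near=> x; apply/andP; split; near: x.
    by move: V_tail' => /cvgr_ge; apply; rewrite invf_lt1// ltr1n.
  by move: V_tail' => /cvgr_le; apply; rewrite ltr1n.
have v_gt0 x : 0 < survival v x.
  have [M [_ HM]] : \forall x \near +oo, 0 < survival v x.
    apply: filterS V_ratio => y /andP[h _].
    rewrite lt_neqAle survival_ge0 andbT eq_sym; apply/eqP => h0.
    by move: h; rewrite h0 mul0r leNgt invr_gt0 ltr0n.
  apply: (lt_le_trans (HM (Num.max (M + 1) x) _)).
    by rewrite lt_max ltrDl ltr01.
  by apply: survival_noninc; rewrite le_max lexx orbT.
(* [mean V] is 0 if the expectation is 0 or infinite; [X] would have density 0 *)
have m0 : 0 < m.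
  rewrite lt_neqAle; apply/andP; split; last first.
    by rewrite /m /mean fine_ge0// expectation_ge0.
  apply/eqP => m00; have := X_density setT measurableT.
  rewrite probability_setT setTI -/m -m00.
  rewrite integral0_eq; last by move=> t _; rewrite invr0 mulr0.
  by move/eqP; rewrite onee_eq0.
have densE (B : set R) : measurable B -> B `<=` `]0, +oo[%classic ->
    (nu B = \int[lebesgue_measure]_(t in B) (survival v t / m)%:E)%E.
  by move=> mB B0; rewrite /nu X_density// -tailV setIidl.
have nu_pos : nu `]0, +oo[%classic = 1%E.
  have XT := X_density setT measurableT.
  by rewrite probability_setT setTI in XT; rewrite /nu X_density// setIid XT.
have nuE x : 0 <= x -> (\int[lebesgue_measure]_(y in `]x, +oo[)
    (survival v y / m)%:E = (survival nu x)%:E)%E.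
  move=> x0; rewrite -survivalE; apply/esym/densE => //.
  by apply: subset_itvr; rewrite bnd_simp.
have v1 : v `[0, +oo[%classic = 1%E.
  rewrite -[RHS](probability_setT P) /v /distribution /pushforward; congr (P _).
  by apply/seteqP; split => // t _ /=; rewrite in_itv/= andbT.
pose u rho := survival (distribution P (W rho)).
have u_sol rho : 0 < rho < 1 -> renewal_solution nu rho (u rho).
  move=> rho01; have /andP[rho0 _] := rho01.
  have lam0 : 0 < rho / m by rewrite divr_gt0.
  exact: (lindley_renewal lam0 v1 (A_exp rho rho01) (W_steady rho rho01)
    m0 rho01 erefl nu_pos nuE).
have v_homo : {homo survival v : x y / x <= y >-> y <= x}.
  by move=> x y xy; exact: survival_noninc.
have v_rv : regularly_varying (survival v) (- alpha).
  apply: (asymp_equiv_regularly_varying L_sv L_pos v_gt0).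
  by rewrite -tailV.
have alpha1 : 1 < alpha by lra.
have H_rv : regularly_varying (survival nu) (1 - alpha).
  exact: (integrated_tail_rv m0 v_homo v_gt0 v_rv nuE).
have H_homo : {homo survival nu : x y / x <= y >-> y <= x}.
  by move=> x y xy; exact: survival_noninc.
have H_gt0 x : 0 < survival nu x.
  apply: (@lt_le_trans _ _ (survival nu (Num.max x 0))).
    apply: (integrated_tail_gt0 m0 v_homo v_gt0 nuE).
    by rewrite le_max lexx orbT.
  by apply: survival_noninc; rewrite le_max lexx.
have betaE : 1 - alpha = - (alpha - 1) by ring.
have H_upper r : 0 < r < alpha - 1 -> exists2 C, 0 <= C &
    forall y, 1 <= y -> survival nu y <= C * y `^ (- r).
  move=> hr; apply: (potter_upper hr H_homo H_gt0 (survival_le1 nu)).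
  by rewrite -betaE.
have H_lower r : alpha - 1 < r -> exists2 C, 0 < C &
    \forall y \near +oo, C * y `^ (- r) <= survival nu y.
  move=> hr; have hr' : 0 < alpha - 1 < r by rewrite hr andbT; lra.
  by apply: (potter_lower hr' H_homo H_gt0); rewrite -betaE.
pose a := alpha - 2.
have a0 : 0 < a by rewrite subr_gt0.
have rate_between s : s < a -> exists2 r, 1 + s < r & r < alpha - 1.
  move=> sa; exists ((1 + s + (alpha - 1)) / 2).
    by rewrite ltr_pdivlMr//; move: sa; rewrite /a; lra.
  by rewrite ltr_pdivrMr//; move: sa; rewrite /a; lra.
have [mu [M [mu0 M0 muE mean_le mean_bound]]] : exists mu M, [/\ 0 < mu, 0 <= M,
    (\int[nu]_(y in `]0%R, +oo[) y%:E = mu%:E)%E,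
    forall b, mean_trunc nu b <= mu &
    forall K, 0 < K -> mu <= mean_trunc nu K + M * K `^ (- (a / 2))].
  have a2 : a / 2 < a by lra.
  have [r r1 r2] := rate_between (a / 2) a2.
  have a20 : 0 < a / 2 by rewrite divr_gt0.
  have hr : 0 < r < alpha - 1 by rewrite r2 andbT; lra.
  have [C C0 HC] := H_upper r hr.
  exact: (mean_exists nu_pos (H_gt0 1) C0 a20 r1 HC).
have mean_bound' : exists s M, [/\ 0 < s, 0 <= M &
    forall K, 0 < K -> mu <= mean_trunc nu K + M * K `^ (- s)].
  by exists (a / 2), M; split => //; rewrite divr_gt0.
have mgf_bound s : 0 < s < a -> exists p C, [/\ 0 < p <= 1, 0 <= C &
    forall gamma b, 0 <= gamma -> 0 < b -> mgf_trunc nu gamma b <=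
      1 + gamma * mu + C * gamma `^ (1 + p) + C * expR (gamma * b) * b `^ (- (1 + s))].
  move=> /andP[s0 sa]; have [r r1 r2] := rate_between s sa.
  have hr : 0 < r < alpha - 1 by rewrite r2 andbT; lra.
  have [C0 C00 HC0] := H_upper r hr.
  have p01 : 0 < Num.min 1 s <= 1 by rewrite lt_min ltr01 s0 ge_min lexx.
  have ps : Num.min 1 s <= s by rewrite ge_min lexx orbT.
  have [C C1 HC] := mgf_trunc_bound nu_pos s0 p01 ps r1 C00 HC0.
  exists (Num.min 1 s), C; split => // g b g0 b0.
  by rewrite (le_trans (HC g b g0 b0))// !lerD2r lerD2l ler_wpM2l.
have secondE : second_moment V = 2 * m * mu.
  have := second_moment_stationary_excess m0 nuE v1.
  rewrite muE -EFinM => h; rewrite /second_moment unlock.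
  rewrite -[RHS]/(fine (2 * m * mu)%:E) -h /v ge0_integral_distribution//.
  - by apply/measurable_EFinP; exact: exprn_measurable.
  - by move=> y; rewrite lee_fin sqr_ge0.
have kE : kappa = a * mu.
  rewrite kappaE secondE -/m -/a; field.
  by rewrite gt_eqF.
have ca0 : 0 < c * a by rewrite mulr_gt0.
have [c1 [C1 [c10 C10 HL]]] : exists c1 C1, [/\ 0 < c1, 0 < C1 &
    \forall x \near +oo,
      c1 * L x <= x `^ (alpha - 1) * survival nu x <= C1 * L x].
  have [c1 [C1 [c10 C10 HK]]] :=
    integrated_tail_karamata m0 alpha1 v_homo v_gt0 v_rv nuE.
  exists (c1 / 2), (C1 * 2); split; [by rewrite divr_gt0|by rewrite mulr_gt0|].
  near=> x; have x0 : 0 < x by near: x; exact: nbhs_pinfty_gt.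
  have Lx : 0 < L x by near: x.
  have pa : 0 < x `^ (alpha - 1) by exact: powR_gt0.
  have xa : x `^ (- alpha) = (x * x `^ (alpha - 1))^-1.
    rewrite powRN; congr (_^-1).
    rewrite -[X in X * _]powRr1 ?(ltW x0)// -powRD ?(gt_eqF x0) ?implybT//.
    by congr (_ `^ _); ring.
  have /andP[k1 k2] : c1 * (x * survival v x) <= survival nu x
      <= C1 * (x * survival v x) by near: x.
  have : 2^-1 <= survival v x / (L x * x `^ (- alpha)) <= 2 by near: x.
  have xx0 : 0 < x * x `^ (alpha - 1) by rewrite mulr_gt0.
  have LE : L x * x `^ (- alpha) = L x / (x * x `^ (alpha - 1)) by rewrite xa.
  rewrite LE invf_div mulrA ler_pdivlMr// ler_pdivrMr// => /andP[l1 l2].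
  apply/andP; split.
    have := ler_wpM2l (ltW pa) k1; apply: le_trans.
    have -> : x `^ (alpha - 1) * (c1 * (x * survival v x)) =
      c1 * (survival v x * (x * x `^ (alpha - 1))) by ring.
    by rewrite -mulrA ler_wpM2l ?(ltW c10).
  have := ler_wpM2l (ltW pa) k2; move/le_trans; apply.
  have -> : x `^ (alpha - 1) * (C1 * (x * survival v x)) =
      C1 * (survival v x * (x * x `^ (alpha - 1))) by ring.
  by rewrite -mulrA ler_wpM2l ?(ltW C10).
have decay_exp rho x : - (2 * (1 - rho) * mean V * x / second_moment V) =
    - (decay_rate mu rho * x).
  rewrite secondE -/m /decay_rate; congr (- _); field.
  by rewrite !gt_eqF.
have rhohat_decay x rho : 0 < x ->
    (rhohat x <= rho) = (decay_rate mu rho <= c * a * log_rate x).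
  move=> x0; rewrite rhohatE// kE /decay_rate ler_pdivrMr// /log_rate.
  rewrite lerBlDr -lerBlDl; congr (_ <= _); ring.
have decay_rhohat x rho : 0 < x ->
    (rho <= rhohat x) = (c * a * log_rate x <= decay_rate mu rho).
  move=> x0; rewrite rhohatE// kE /decay_rate ler_pdivlMr// /log_rate.
  rewrite lerBrDr -lerBrDl; congr (_ <= _); ring.
have ck : 0 < c * (a * mu) by rewrite !mulr_gt0.
have rhohat_pos : \forall x \near +oo, 0 < rhohat x < 1.
  near=> x; have x0 : 0 < x by near: x; exact: nbhs_pinfty_gt.
  have l1 : 1 <= ln x by near: x; exact: near_ln_ge.
  have lr0 : 0 < log_rate x by rewrite divr_gt0//; lra.
  have : c * (a * mu) * log_rate x <= 2^-1.
    by near: x; apply: near_log_rate_le => //; exact: ltW.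
  have := mulr_gt0 ck lr0.
  rewrite rhohatE// kE -/(log_rate x) => p1 p2.
  apply/andP; split; last by lra.
  by rewrite subr_gt0 (le_lt_trans p2)// invf_lt1// ltr1n.
move=> heavy_traffic heavy_tail.
have traffic : (forall e, 0 < e -> \forall x \near +oo, forall rho, 0 < rho < 1 ->
      decay_rate mu rho <= c * a * log_rate x ->
      u rho x <= (expR e + e) * expR (- (decay_rate mu rho * x))) ->
    heavy_traffic.
  move=> up; apply: uniformly_asymp_equiv_near => e e0.
  have [dl dl0 [e1 e2]] := small_exponent e0.
  near=> x; have x0 : 0 < x by near: x; exact: nbhs_pinfty_gt.
  have /andP[h0 h1] : 0 < rhohat x < 1 by near: x.
  have upx : forall rho, 0 < rho < 1 -> decay_rate mu rho <= c * a * log_rate x ->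
      u rho x <= (expR dl + dl) * expR (- (decay_rate mu rho * x)).
    by near: x; exact: up.
  have lox : forall rho, 0 < rho < 1 -> decay_rate mu rho <= c * a * log_rate x ->
      expR (- dl) * expR (- (decay_rate mu rho * x)) <= u rho x.
    near: x; exact: (exponential_lower nu_pos mu0 u_sol mean_bound' mean_le).
  split; first by exists (rhohat x) => /=; rewrite lexx.
  move=> rho /= /andP[r1 r2]; have rho01 : 0 < rho < 1 by rewrite r2 (lt_le_trans h0).
  rewrite rhohat_decay// in r1.
  rewrite decay_exp tail_survival; apply: ratio_dist_le; first exact: expR_gt0.
    by apply: le_trans (lox rho rho01 r1); rewrite ler_wpM2r// expR_ge0.
  by apply: (le_trans (upx rho rho01 r1)); rewrite ler_wpM2r// expR_ge0.
have tails : (forall K, 0 < K -> \forall x \near +oo,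
      K * ln x <= x `^ (1 + c * a) * survival nu x) -> heavy_tail.
  move=> HQ; apply: uniformly_asymp_equiv_near => e e0.
  near=> x; have x0 : 0 < x by near: x; exact: nbhs_pinfty_gt.
  have /andP[h0 h1] : 0 < rhohat x < 1 by near: x.
  have upx : forall rho, 0 < rho < 1 -> c * a * log_rate x <= decay_rate mu rho ->
      u rho x <= (1 + e) * (rho / (1 - rho) * survival nu x).
    near: x; exact: (heavy_tail_upper nu_pos alpha_gt2 mu0 u_sol mgf_bound H_gt0 H_rv
      H_lower ca0 e0 HQ).
  have lox : forall rho, 0 < rho < 1 -> c * a * log_rate x <= decay_rate mu rho ->
      rho / (1 - rho) * survival nu x <= (1 + e) * u rho x.
    near: x; exact: (heavy_tail_lower nu_pos alpha_gt2 mu0 u_sol H_gt0 H_upper ca0 e0).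
  split; first by exists (rhohat x) => /=; rewrite h0 lexx.
  move=> rho /= /andP[r1 r2].
  have rho01 : 0 < rho < 1 by rewrite r1 (le_lt_trans r2).
  rewrite decay_rhohat// in r2.
  have den0 : 0 < rho / (1 - rho) * survival nu x.
    by rewrite mulr_gt0// divr_gt0// subr_gt0; case/andP: rho01.
  rewrite tailX tail_survival; apply: ratio_dist_le => //; last exact: upx.
  have := lox rho rho01 r2; have u0 := survival_ge0 (distribution P (W rho)) x.
  have [e1|e1] := leP 1 e.
    move=> _; apply: le_trans u0; rewrite mulr_le0_ge0 ?(ltW den0)//; lra.
  rewrite -/(u rho x) in u0 * => lo.
  have := ler_wpM2l (_ : 0 <= 1 - e) lo => /(_ _)/le_trans; apply; first lra.
  rewrite mulrA ler_piMl//; have := sqr_ge0 e; lra.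
split.
- move=> c1lt; apply: traffic => e e0.
  have caa : 0 < c * a < a by rewrite ca0 gtr_pMl.
  have H := exponential_upper nu_pos mu0 u_sol mgf_bound caa e0.
  apply: filterS H => x H rho rho01 th; apply: (le_trans (H rho rho01 th)).
  by rewrite ler_wpM2r ?expR_ge0// lerDl ltW.
- move=> cE Lln; apply: traffic => e e0.
  rewrite cE mul1r.
  have caa : 0 < a / 2 < a by apply/andP; split; lra.
  have H := exponential_upper nu_pos mu0 u_sol mgf_bound caa e0.
  have HL' K : 0 < K -> \forall x \near +oo,
      x `^ (alpha - 1) * survival nu x <= K * ln x.
    move=> K0; near=> x.
    have l1 : 1 <= ln x by near: x; exact: near_ln_ge.
    have /andP[_ h] : c1 * L x <= x `^ (alpha - 1) * survival nu x <= C1 * L x by near: x.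
    apply: (le_trans h).
    have : L x / ln x <= K / C1.
      by near: x; move: Lln => /cvgr_le; apply; rewrite divr_gt0.
    rewrite ler_pdivrMr; last by lra.
    move/(ler_wpM2l (ltW C10)).
    by have -> : C1 * (K / C1 * ln x) = K * ln x by field; rewrite gt_eqF.
  have H2 := exponential_upper_critical nu_pos alpha_gt2 mu0 u_sol mgf_bound H_gt0 H_rv e0 HL'.
  near=> x => rho rho01 th.
  have [th2|th2] := leP (decay_rate mu rho) (a / 2 * log_rate x).
    have Hx : forall rho, 0 < rho < 1 -> decay_rate mu rho <= a / 2 * log_rate x ->
      u rho x <= expR e * expR (- (decay_rate mu rho * x)) by near: x.
    apply: (le_trans (Hx rho rho01 th2)).
    by rewrite ler_wpM2r ?expR_ge0// lerDl ltW.
  have Hx : forall rho, 0 < rho < 1 ->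
    a / 2 * log_rate x <= decay_rate mu rho <= a * log_rate x ->
    u rho x <= (expR e + e) * expR (- (decay_rate mu rho * x)) by near: x.
  by apply: Hx => //; rewrite th andbT ltW.
- move=> c1lt; apply: tails => K K0.
  have aca : a < c * a by rewrite ltr_pMl.
  pose r := (2 + a + c * a) / 2.
  have r1 : alpha - 1 < r by rewrite /r /a in aca *; lra.
  have r2 : 0 < 1 + c * a - r by rewrite /r; lra.
  have [cc cc0 Hcc] := H_lower r r1.
  near=> x; have x0 : 0 < x by near: x; exact: nbhs_pinfty_gt.
  have h : cc * x `^ (- r) <= survival nu x by near: x.
  have h2 : K * ln x * x `^ (- (1 + c * a - r)) <= cc.
    by near: x; apply: near_ln_powR_le => //; rewrite ltW.
  have pp : 0 < x `^ (1 + c * a) by exact: powR_gt0.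
  apply: le_trans (ler_wpM2l (ltW pp) h).
  have -> : x `^ (1 + c * a) * (cc * x `^ (- r)) = cc * x `^ (1 + c * a - r).
    by rewrite mulrCA -powRD ?(gt_eqF x0) ?implybT.
  by rewrite powRN ler_pdivrMr ?powR_gt0// in h2.
- move=> cE Lln; apply: tails => K K0; rewrite cE mul1r.
  near=> x.
  have l1 : 1 <= ln x by near: x; exact: near_ln_ge.
  have /andP[h _] : c1 * L x <= x `^ (alpha - 1) * survival nu x <= C1 * L x by near: x.
  have -> : 1 + a = alpha - 1 by rewrite /a; ring.
  apply: le_trans h.
  have : K / c1 <= L x / ln x by near: x; move: Lln => /cvgryPge; apply.
  rewrite ler_pdivlMr; last by lra.
  move/(ler_wpM2l (ltW c10)).
  by have -> : c1 * (K / c1 * ln x) = K * ln x by field; rewrite gt_eqF.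
Unshelve. all: by end_near. Qed.
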